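(* Consider the adaptive system $$\dot x=A_px+bu,\qquad \dot x_m=A_mx_m+br+\ell(x-x_m),$$ $$u=\theta^Tx+r,\qquad \dot\theta=\mathrm{Proj}_\Gamma\left(\theta,-xe^TPb,f\right),\qquad e=x-x_m,$$ with all objects as in the context (in particular the matching condition $A_m=A_p+b\theta^{*T}$ and $\|\theta^*\|\le\theta^*_{max}$ hold). For any initial condition $e(0)\in\mathbb R^n$ and any $\theta(0)$ with $\|\theta(0)\|\le\theta_{\max}$, the signals $e(t)$ and $\theta(t)$ are uniformly bounded for all $t\ge0$, and, with $$V(e,\tilde\theta)=e^TPe+\tilde\theta^T\Gamma^{-1}\tilde\theta ,\qquad \tilde\theta=\theta-\theta^*,$$ one has along trajectories $$\dot V\le-\alpha_1V+\alpha_2,\qquad \alpha_1=\frac{\sigma+2\ell}{m^2},\qquad \alpha_2=\frac{\sigma+2\ell}{m^2\gamma}\,\tilde\theta_{\max}^2,$$ and $(e,\tilde\theta)$ converges exponentially to the set $$\mathcal E=\left\{(e,\tilde\theta):\ \|e\|^2\le\beta_1\tilde\theta_{\max}^2,\ \|\tilde\theta\|\le\tilde\theta_{\max}\right\},\qquad \beta_1=\frac{2(s+\ell)}{\gamma}.$$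
   Context: $\|\cdot\|$ is the Euclidean norm (induced norm for matrices). $A_p\in\mathbb R^{n\times n}$, $b\in\mathbb R^n$, $A_m\in\mathbb R^{n\times n}$ is Hurwitz, $r:[0,\infty)\to\mathbb R$ is bounded, $\ell\ge0$, $\gamma>0$, $\Gamma=\gamma I_{n\times n}$. $\theta^*\in\mathbb R^n$ satisfies $A_m=A_p+b\theta^{*T}$ and $\|\theta^*\|\le\theta^*_{max}$, with $\theta^*_{max}>0$ known. $\bar A_m=A_m-\ell I_{n\times n}$ and $P=P^T>0$ solves $\bar A_m^TP+P\bar A_m=-I_{n\times n}$. Constants: $\sigma=-\max_i\mathrm{Re}\,\lambda_i(A_m)$, $s=-\min_i\lambda_i\big((A_m+A_m^T)/2\big)$, $a=\|A_m\|$, $m=(1+4a/\sigma)^{n-1}$. Projection: with $\vartheta=\theta^*_{max}$ and a design constant $\varepsilon>0$, $f(\theta)=\dfrac{\|\theta\|^2-\vartheta^2}{2\varepsilon\vartheta+\varepsilon^2}$, $\theta_{\max}=\vartheta+\varepsilon$, $\tilde\theta_{\max}=2\vartheta+\varepsilon$, and $$\mathrm{Proj}_\Gamma(\theta,y,f)=\begin{cases}\Gamma y-\Gamma\dfrac{\nabla f(\theta)\nabla f(\theta)^T}{\nabla f(\theta)^T\Gamma\nabla f(\theta)}\Gamma y\,f(\theta)&\text{if }f(\theta)>0\text{ and }y^T\Gamma\nabla f(\theta)>0,\\ \Gamma y&\text{otherwise.}\end{cases}$$ *)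

(* Defs.v *)
From HB Require Import structures.
From mathcomp Require Import all_boot all_order all_algebra.
From mathcomp Require Import complex.
From mathcomp Require Import all_classical all_reals all_analysis.

Set Implicit Arguments.
Unset Strict Implicit.
Unset Printing Implicit Defensive.

Import Order.TTheory GRing.Theory Num.Theory.
Import numFieldNormedType.Exports.

Local Open Scope classical_set_scope.
Local Open Scope ring_scope.

Section LinearAlgebra.
Context {R : realType} {n : nat}.
Implicit Types (u v y g : 'cV[R]_n) (A G : 'M[R]_n).

Definition dotp u v : R := (u^T *m v) 0 0.

(* Euclidean norm; the library norm `|v| on matrices is the max norm. *)
Definition enorm v : R := Num.sqrt (dotp v v).

Definition opnorm A : R := sup [set enorm (A *m v) | v in [set v | enorm v <= 1]].

Definition posdef A : Prop := forall v, v != 0 -> 0 < dotp v (A *m v).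

Definition cspectrum A : set R[i] :=
  [set z | eigenvalue (map_mx (real_complex R) A) z].

Definition hurwitz A : Prop := forall z, cspectrum A z -> complex.Re z < 0.

(* For 0 < n, the sup and the inf below range over nonempty finite sets,
   so they are a maximum and a minimum. *)
Definition stability_margin A : R :=
  - sup [set complex.Re z | z in cspectrum A].

Definition sym_margin A : R :=
  - inf [set x : R | eigenvalue (2^-1 *: (A + A^T)) x].

Definition transient_gain A : R :=
  (1 + 4 * opnorm A / stability_margin A) ^+ n.-1.

Definition grad (f : 'cV[R]_n -> R) (th : 'cV[R]_n) : 'cV[R]_n :=
  \col_i 'D_(delta_mx i 0) f th.

Definition proj G (th y : 'cV[R]_n) (f : 'cV[R]_n -> R) : 'cV[R]_n :=
  let g := grad f th in
  if (0 < f th) && (0 < dotp y (G *m g)) then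
    G *m y - (f th / dotp g (G *m g)) *: (G *m (g *m g^T) *m (G *m y))
  else G *m y.

Definition proj_bound (vth eps : R) (th : 'cV[R]_n) : R :=
  (enorm th ^+ 2 - vth ^+ 2) / (2 * eps * vth + eps ^+ 2).

Definition dist_to (E : set ('cV[R]_n * 'cV[R]_n)) (z : 'cV[R]_n * 'cV[R]_n) : R :=
  inf [set Num.sqrt (enorm (z.1 - w.1) ^+ 2 + enorm (z.2 - w.2) ^+ 2) | w in E].

End LinearAlgebra.

Section Dynamics.
Context {R : realType} {n : nat}.

(* The time interval [0, T), where T may be +oo. *)
Definition times (T : \bar R) : set R := [set t | 0 <= t /\ (t%:E < T)%E].

(* z' = F on [0, T) in the sense of Caratheodory: the right-hand side F, already
   evaluated along the trajectory, is locally integrable and z is the integral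
   of F.  Since the reference input is only assumed bounded, z' need not exist
   at every time; where F is continuous, z' = F holds pointwise. *)
Definition solves (T : \bar R) (z F : R -> 'cV[R]_n) : Prop :=
  forall t, times T t -> forall i,
    (@lebesgue_measure R).-integrable `[0, t] (fun s => (F s i 0)%:E) /\
    z t i 0 = z 0 i 0 + (\int[@lebesgue_measure R]_(s in `[0, t]) F s i 0)%R.

(* l is the derivative at t of h restricted to D: the usual derivative at
   interior points of D, the one-sided one at an endpoint. *)
Definition has_derivative_within (D : set R) (h : R -> R) (t l : R) : Prop :=
  (fun s => (h s - h t) / (s - t)) @ within D t^' --> l.

(* The closed loop with u = th^T x + r and e = x - xm. *)
Definition closed_loop (Ap Am P G : 'M[R]_n) (b : 'cV[R]_n) (r : R -> R)
    (ell : R) (f : 'cV[R]_n -> R) (T : \bar R) (x xm th : R -> 'cV[R]_n) : Prop :=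
  let u t := dotp (th t) (x t) + r t in
  let e t := x t - xm t in
  [/\ solves T x (fun t => Ap *m x t + u t *: b),
      solves T xm (fun t => Am *m xm t + r t *: b + ell *: (x t - xm t)) &
      solves T th (fun t => proj G (th t) (- (x t *m (e t)^T *m P *m b)) f)].

Definition lyap (P G : 'M[R]_n) (e tth : 'cV[R]_n) : R :=
  dotp e (P *m e) + dotp tth (invmx G *m tth).

End Dynamics.

(* Main.v *)
Require Import Defs.
From HB Require Import structures.
From mathcomp Require Import all_boot all_order all_algebra.
From mathcomp Require Import complex ring lra.
From mathcomp Require Import all_classical all_reals all_analysis.

Import Order.TTheory GRing.Theory Num.Theory.
Import numFieldNormedType.Exports.

Local Open Scope classical_set_scope.
Local Open Scope ring_scope.

(** The reference input cancels in the error dynamics, which read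
    [e' = (Am - ell) e + (th - ths)^T x b], so [V] is differentiable at every
    time although [r] is only bounded.  Along a trajectory the cross terms of
    [V'] cancel against the unprojected adaptation law, and the projection only
    helps since [|ths| <= thsmax]; hence [V' <= - |e|^2].  The projection also
    points inward on [|th| = thsmax + eps].

    It remains to compare [P] with the identity.  For the upper bound, [P] is
    compared with a weighted Euclidean norm [Q]: if [l] is the largest
    generalized eigenvalue of the pencil [P - l Q] and [v] its eigenvector,
    evaluating the Lyapunov equation at [v] bounds [l].  The weight [Q] is
    geometric in complex Schur coordinates of [Am], with ratio
    [(1 + 4 a / sigma)^2], which is where the gain [m] comes from.  The lower
    bound [1 / (2 (s + ell))] is the same argument at the smallest eigenvalue
    of [P].  Then [V - tthmax^2 / gamma] decays exponentially and controls
    the excess of [|e|^2] over [beta1 * tthmax^2]. *)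

(** * Euclidean geometry *)

Section InnerProduct.
Context {R : realType} {n : nat}.
Implicit Types (u v w : 'cV[R]_n) (A : 'M[R]_n).

Lemma dotpE u v : dotp u v = \sum_i u i 0 * v i 0.
Proof. by rewrite /dotp !mxE; apply: eq_bigr => i _; rewrite mxE. Qed.

Lemma dotpC u v : dotp u v = dotp v u.
Proof. by rewrite !dotpE; apply: eq_bigr => i _; rewrite mulrC. Qed.

Lemma dotpDl u v w : dotp (u + v) w = dotp u w + dotp v w.
Proof. by rewrite /dotp linearD mulmxDl mxE. Qed.

Lemma dotpDr u v w : dotp w (u + v) = dotp w u + dotp w v.
Proof. by rewrite dotpC dotpDl !(dotpC w). Qed.

Lemma dotpZl a u v : dotp (a *: u) v = a * dotp u v.
Proof. by rewrite /dotp linearZ -scalemxAl mxE. Qed.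

Lemma dotpZr a u v : dotp u (a *: v) = a * dotp u v.
Proof. by rewrite dotpC dotpZl dotpC. Qed.

Lemma dotpNl u v : dotp (- u) v = - dotp u v.
Proof. by rewrite -scaleN1r dotpZl mulN1r. Qed.

Lemma dotpNr u v : dotp u (- v) = - dotp u v.
Proof. by rewrite dotpC dotpNl dotpC. Qed.

Lemma dotpBl u v w : dotp (u - v) w = dotp u w - dotp v w.
Proof. by rewrite dotpDl dotpNl. Qed.

Lemma dotpBr u v w : dotp w (u - v) = dotp w u - dotp w v.
Proof. by rewrite dotpDr dotpNr. Qed.

Lemma dotp0l u : dotp 0 u = 0.
Proof. by rewrite -(scale0r u) dotpZl mul0r. Qed.

Lemma dotp0r u : dotp u 0 = 0.
Proof. by rewrite dotpC dotp0l. Qed.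

Lemma dotp_mulmx A u v : dotp u (A *m v) = dotp (A^T *m u) v.
Proof. by rewrite /dotp trmx_mul trmxK mulmxA. Qed.

Lemma dotp_sym A u v : A^T = A -> dotp u (A *m v) = dotp v (A *m u).
Proof. by move=> sA; rewrite dotp_mulmx sA dotpC. Qed.

Lemma dotp_ge0 u : 0 <= dotp u u.
Proof. by rewrite dotpE sumr_ge0 // => i _; rewrite -expr2 sqr_ge0. Qed.

Lemma dotp_eq0 u : (dotp u u == 0) = (u == 0).
Proof.
apply/idP/eqP => [|->]; last by rewrite dotp0l.
rewrite dotpE psumr_eq0 => [/allP /= u0|i _]; last by rewrite -expr2 sqr_ge0.
apply/matrixP => i j; rewrite ord1 mxE.
by have /= := u0 i (mem_index_enum i); rewrite mulf_eq0 orbb => /eqP.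
Qed.

Lemma dotp_gt0 u : (0 < dotp u u) = (u != 0).
Proof. by rewrite lt_neqAle dotp_ge0 andbT eq_sym dotp_eq0. Qed.

Lemma enorm_ge0 u : 0 <= enorm u.
Proof. exact: sqrtr_ge0. Qed.

Lemma sqr_enorm u : enorm u ^+ 2 = dotp u u.
Proof. by rewrite sqr_sqrtr ?dotp_ge0. Qed.

Lemma enorm0 : enorm (0 : 'cV[R]_n) = 0.
Proof. by rewrite /enorm dotp0l sqrtr0. Qed.

Lemma enorm_eq0 u : (enorm u == 0) = (u == 0).
Proof. by rewrite -dotp_eq0 -sqr_enorm expf_eq0. Qed.

Lemma enormZ a u : enorm (a *: u) = `|a| * enorm u.
Proof.
by rewrite /enorm dotpZl dotpZr mulrA -expr2 sqrtrM ?sqr_ge0 // sqrtr_sqr.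
Qed.

Lemma enorm_le u (c : R) : 0 <= c -> (enorm u <= c) = (dotp u u <= c ^+ 2).
Proof. by move=> c0; rewrite -sqr_enorm ler_pXn2r // nnegrE enorm_ge0. Qed.

(** The squared norm of [dotp v v *: u - dotp u v *: v] expands to [dotp v v] times the difference
    of the two sides. *)
Lemma cauchy_schwarz u v : dotp u v ^+ 2 <= dotp u u * dotp v v.
Proof.
have [->|v0] := eqVneq v 0; first by rewrite !dotp0r mulr0 expr0n.
have vp : 0 < dotp v v by rewrite dotp_gt0.
have := dotp_ge0 (dotp v v *: u - dotp u v *: v).
rewrite dotpBl !dotpBr !dotpZl !dotpZr (dotpC v u) => h.
rewrite -(ler_pM2l vp) -subr_ge0.
by apply: le_trans h _; rewrite le_eqVlt; apply/orP; left; apply/eqP; ring.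
Qed.

Lemma ler_dotp u v : dotp u v <= enorm u * enorm v.
Proof.
apply: le_trans (ler_norm _) _.
rewrite -(@ler_pXn2r _ 2) ?nnegrE ?mulr_ge0 ?enorm_ge0 //.
by rewrite exprMn !sqr_enorm real_normK ?num_real // cauchy_schwarz.
Qed.

Lemma ler_enormD u v : enorm (u + v) <= enorm u + enorm v.
Proof.
rewrite enorm_le ?addr_ge0 ?enorm_ge0 // sqrrD !sqr_enorm dotpDl !dotpDr.
rewrite (dotpC v u); have := ler_dotp u v; lra.
Qed.

Lemma enormN u : enorm (- u) = enorm u.
Proof. by rewrite -scaleN1r enormZ normrN normr1 mul1r. Qed.

(** Convergence is taken coordinatewise and along any filter, because solutions are given by
    coordinates and are continuous only within a segment. *)
Lemma cvg_dotp (T : Type) (F : set_system T) {FF : Filter F}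
    (f g : T -> 'cV[R]_n) u v :
  (forall i, f x i 0 @[x --> F] --> u i 0) ->
  (forall i, g x i 0 @[x --> F] --> v i 0) ->
  dotp (f x) (g x) @[x --> F] --> dotp u v.
Proof.
move=> fu gv; rewrite dotpE; under eq_cvg do rewrite dotpE.
by apply: cvg_big => [|i _]; [exact: add_continuous | apply: cvgM].
Qed.

Lemma cvg_mulmx (T : Type) (F : set_system T) {FF : Filter F} A
    (f : T -> 'cV[R]_n) u :
  (forall i, f x i 0 @[x --> F] --> u i 0) ->
  forall i, (A *m f x) i 0 @[x --> F] --> (A *m u) i 0.
Proof.
move=> fu i; rewrite mxE; under eq_cvg do rewrite mxE.
apply: cvg_big => [|j _]; first exact: add_continuous.
by apply: cvgM => //; exact: cvg_cst.
Qed.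

End InnerProduct.

(** * The induced operator norm *)

Section OperatorNorm.
Context {R : realType} {n : nat}.
Implicit Types (u v : 'cV[R]_n) (A : 'M[R]_n).

(** Cauchy-Schwarz on each row. This Frobenius bound shows that the supremum defining [opnorm] is
    finite. *)
Lemma dotp_mulmx_frobenius A v :
  dotp (A *m v) (A *m v) <= (\sum_i dotp (row i A)^T (row i A)^T) * dotp v v.
Proof.
rewrite [leLHS]dotpE mulr_suml; apply: ler_sum => i _.
suff -> : (A *m v) i 0 = dotp (row i A)^T v by rewrite -expr2 cauchy_schwarz.
by rewrite dotpE mxE; apply: eq_bigr => j _; rewrite !mxE.
Qed.

Lemma opnorm_has_sup A :
  has_sup [set enorm (A *m v) | v in [set v | enorm v <= 1]].
Proof.
split; first by exists (enorm (A *m 0)), 0 => //=; rewrite enorm0 ler01.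
exists (Num.sqrt (\sum_i dotp (row i A)^T (row i A)^T)) => _ [v /= v1 <-].
rewrite ler_sqrt; last by apply: sumr_ge0 => i _; exact: dotp_ge0.
apply: le_trans (dotp_mulmx_frobenius _ _) _; rewrite -[leRHS]mulr1.
rewrite ler_wpM2l ?sumr_ge0 // => [i _|]; first exact: dotp_ge0.
by move: v1; rewrite enorm_le // expr1n.
Qed.

Lemma opnorm_ge0 A : 0 <= opnorm A.
Proof.
rewrite /opnorm -(enorm0 (R := R) (n := n)) -(mulmx0 _ A).
apply: ub_le_sup; first exact: (opnorm_has_sup A).2.
by exists 0 => //=; rewrite enorm0 ler01.
Qed.

Lemma enorm_mulmx_le A v : enorm (A *m v) <= opnorm A * enorm v.
Proof.
have [->|v0] := eqVneq v 0; first by rewrite mulmx0 enorm0 mulr0.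
have vp : 0 < enorm v by rewrite lt_neqAle enorm_ge0 andbT eq_sym enorm_eq0.
rewrite -ler_pdivrMr // mulrC -[X in X * _]ger0_norm ?invr_ge0 ?enorm_ge0 //.
rewrite -enormZ scalemxAr; apply: ub_le_sup; first exact: (opnorm_has_sup A).2.
exists ((enorm v)^-1 *: v) => //=.
by rewrite enormZ ger0_norm ?invr_ge0 ?enorm_ge0 // mulVf // gt_eqF.
Qed.

Lemma dotp_mulmx_le A v : dotp (A *m v) (A *m v) <= opnorm A ^+ 2 * dotp v v.
Proof.
rewrite -!sqr_enorm -exprMn ler_pXn2r ?nnegrE ?mulr_ge0 ?enorm_ge0 ?opnorm_ge0 //.
exact: enorm_mulmx_le.
Qed.

End OperatorNorm.

(** * Extremal generalized eigenvalues of symmetric pencils *)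

Section Pencil.
Context {R : realType} {n : nat}.
Implicit Types (u v : 'cV[R]_n) (X Y Z : 'M[R]_n).

(** With [w = Z v], the form at [v - t w] is [- 2 t |w|^2 + t^2 <w, Z w>], which is negative for
    small [t > 0] unless [w = 0]. *)
Lemma psd_kernel Z v : Z^T = Z -> (forall u, 0 <= dotp u (Z *m u)) ->
  dotp v (Z *m v) = 0 -> Z *m v = 0.
Proof.
move=> sZ Zge0 v0; apply/eqP; rewrite -dotp_eq0; apply/negPn/negP => z0.
set w := Z *m v in z0 *; set d := dotp w w in z0 *.
have d0 : 0 < d by rewrite lt_neqAle eq_sym z0 dotp_ge0.
set q := dotp w (Z *m w).
have q0 : 0 <= q by exact: Zge0.
(* This [t] makes the linear term dominate; the added 1 keeps the denominator positive when
   [q = 0]. *)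
have /(_ (d / (1 + q))) : forall t, 0 <= - 2 * t * d + t ^+ 2 * q.
  move=> t; have := Zge0 (v - t *: w).
  rewrite mulmxBr -scalemxAr !dotpBl !dotpBr !dotpZl !dotpZr v0.
  rewrite (dotp_sym _ v w sZ) -/q -/w -/d; lra.
have -> : - 2 * (d / (1 + q)) * d + (d / (1 + q)) ^+ 2 * q
  = - (d ^+ 2 / (1 + q)) * (1 + (1 + q)^-1).
  by field; rewrite gt_eqF // ltr_pwDl.
apply/negP; rewrite -ltNge mulNr oppr_lt0 mulr_gt0 //.
  by rewrite divr_gt0 ?exprn_gt0 // ltr_pwDl.
by rewrite addr_gt0 // invr_gt0 ltr_pwDl.
Qed.

(** The quotient of the two forms attains its maximum [l] on the unit sphere. Then [l Y - X] is
    positive semidefinite and its form vanishes at the maximizer, which [psd_kernel] turns into an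
    eigenvector. *)
Lemma pencil_max X Y : (0 < n)%N -> X^T = X -> Y^T = Y -> posdef Y ->
  exists l v, [/\ v != 0, X *m v = l *: (Y *m v) &
    forall u, dotp u (X *m u) <= l * dotp u (Y *m u)].
Proof.
move=> n0 sX sY Yp.
(* The sphere consists of row vectors, to which [bounded_closed_compact] applies. *)
pose S := [set w : 'rV[R]_n | dotp w^T w^T = 1].
pose q (M : 'M[R]_n) (w : 'rV[R]_n) := dotp w^T (M *m w^T).
have coord (w : 'rV[R]_n) i : (x : 'rV[R]_n)^T i 0 @[x --> w] --> w^T i 0.
  by rewrite mxE; under eq_cvg do rewrite mxE; exact: coord_continuous.
have qC M : continuous (q M).
  move=> w; apply: (@cvg_dotp _ _ _ (nbhs w) _ (fun x : 'rV[R]_n => x^T) (fun x => M *m x^T)).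
    exact: coord.
  exact: (@cvg_mulmx _ _ _ (nbhs w) _ M (fun x : 'rV[R]_n => x^T) _ (coord w)).
have S0 : S !=set0.
  exists (delta_mx 0 (Ordinal n0)); rewrite /S /= trmx_delta dotpE.
  rewrite (bigD1 (Ordinal n0)) //= mxE !eqxx mulr1 big1 ?addr0 // => i ni.
  by rewrite mxE (negbTE ni) mul0r.
have Scl : closed S.
  rewrite -[S]/((fun w : 'rV[R]_n => dotp w^T w^T) @^-1` [set x : R | x = 1]).
  apply: closed_comp; last exact: closed_eq.
  move=> w _.
  by apply: (@cvg_dotp _ _ _ (nbhs w) _ (fun x => x^T) (fun x => x^T)); exact: coord.
have Sb : bounded_set S.
  exists 1; split; first exact: num_real.
  move=> M M1 w Sw; apply: le_trans (ltW M1); rewrite /Num.Def.normr /= mx_normrE.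
  apply/bigmax_leP; split => // -[i j] _ /=; rewrite ord1.
  rewrite -(@ler_pXn2r _ 2) ?nnegrE // expr1n real_normK ?num_real //.
  move: Sw; rewrite /S /= dotpE (bigD1 j) //= !mxE expr2 => <-.
  by rewrite lerDl sumr_ge0 // => k _; rewrite -expr2 sqr_ge0.
have SY (w : 'rV[R]_n) : S w -> 0 < q Y w.
  move=> Sw; apply: Yp; apply/eqP => w0.
  by move: Sw; rewrite /S /= w0 dotp0l => /eqP; rewrite eq_sym oner_eq0.
have [||w Sw wmax] := @compact_EVT_max _ R (fun w => q X w / q Y w) S S0.
- exact: bounded_closed_compact.
- apply/continuous_in_subspaceT => w /set_mem Sw.
  apply: (@cvgM _ _ (nbhs w) _ (q X)); first exact: qC.
  by apply: (@cvgV _ _ (nbhs w) _ (q Y)); [rewrite gt_eqF // SY | exact: qC].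
move/set_mem in Sw.
set l := q X w / q Y w in wmax.
have hl u : dotp u (X *m u) <= l * dotp u (Y *m u).
  have [->|u0] := eqVneq u 0; first by rewrite !dotp0l mulr0.
  have Yu := Yp u u0.
  have up : 0 < enorm u by rewrite lt_neqAle enorm_ge0 andbT eq_sym enorm_eq0.
  rewrite -ler_pdivrMr //.
  have /wmax : (enorm u)^-1 *: u^T \in S.
    rewrite inE /S /= linearZ /= trmxK dotpZl dotpZr -sqr_enorm.
    by field; rewrite gt_eqF.
  rewrite /q linearZ /= trmxK -!scalemxAr !dotpZl !dotpZr.
  by congr (_ <= _); field; rewrite !gt_eqF.
exists l, w^T; split => //.
  by apply/eqP => w0; move: Sw; rewrite /S /= w0 dotp0l => /eqP; rewrite eq_sym oner_eq0.
apply/eqP; rewrite -subr_eq0 -opprB oppr_eq0 scalemxAl -mulmxBl; apply/eqP.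
apply: psd_kernel.
- by rewrite linearB linearZ /= sX sY.
- by move=> u; rewrite mulmxBl -scalemxAl dotpBr dotpZr subr_ge0.
- rewrite mulmxBl -scalemxAl dotpBr dotpZr -/(q Y w) -/(q X w) /l.
  by field; rewrite gt_eqF // SY.
Qed.

End Pencil.

(** * A weighted norm adapted to a Hurwitz matrix *)

Section RealSchur.
Context {R : realType}.

Let re {m n} (M : 'M[R[i]]_(m, n)) : 'M[R]_(m, n) := map_mx (@complex.Re R) M.
Let im {m n} (M : 'M[R[i]]_(m, n)) : 'M[R]_(m, n) := map_mx (@complex.Im R) M.

Let Re_sum (I : finType) (F : I -> R[i]) :
  complex.Re (\sum_i F i) = \sum_i complex.Re (F i).
Proof.
apply: (@big_morph _ _ (@complex.Re R) 0 +%R 0 +%R) => // x y.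
by case: x y => [a b] [c d].
Qed.

Let Im_sum (I : finType) (F : I -> R[i]) :
  complex.Im (\sum_i F i) = \sum_i complex.Im (F i).
Proof.
apply: (@big_morph _ _ (@complex.Im R) 0 +%R 0 +%R) => // x y.
by case: x y => [a b] [c d].
Qed.

Let re_mul {m n p} (M : 'M[R[i]]_(m, n)) (N : 'M[R[i]]_(n, p)) :
  re (M *m N) = re M *m re N - im M *m im N.
Proof.
apply/matrixP => i j; rewrite !mxE Re_sum -sumrB; apply: eq_bigr => k _.
by rewrite !mxE; case: (M i k) (N k j) => [a b] [c d].
Qed.

Let im_mul {m n p} (M : 'M[R[i]]_(m, n)) (N : 'M[R[i]]_(n, p)) :
  im (M *m N) = re M *m im N + im M *m re N.
Proof.
apply/matrixP => i j; rewrite !mxE Im_sum -big_split; apply: eq_bigr => k _.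
by rewrite !mxE; case: (M i k) (N k j) => [a b] [c d].
Qed.

Let ConjE (z : R[i]) : Num.conj z = conjc z. Proof. by []. Qed.

Let re_adj {m n} (M : 'M[R[i]]_(m, n)) : re (map_mx Num.conj M^T) = (re M)^T.
Proof. by apply/matrixP => i j; rewrite !mxE ConjE; case: (M j i). Qed.

Let im_adj {m n} (M : 'M[R[i]]_(m, n)) : im (map_mx Num.conj M^T) = - (im M)^T.
Proof. by apply/matrixP => i j; rewrite !mxE ConjE; case: (M j i). Qed.

Let re_real {m n} (M : 'M[R]_(m, n)) : re (map_mx (real_complex R) M) = M.
Proof. by apply/matrixP => i j; rewrite !mxE. Qed.

Let im_real {m n} (M : 'M[R]_(m, n)) : im (map_mx (real_complex R) M) = 0.
Proof. by apply/matrixP => i j; rewrite !mxE. Qed.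

Let re1 n : re (1%:M : 'M[R[i]]_n) = 1%:M.
Proof. by apply/matrixP => i j; rewrite !mxE; case: (i == j). Qed.

Let im1 n : im (1%:M : 'M[R[i]]_n) = 0.
Proof. by apply/matrixP => i j; rewrite !mxE; case: (i == j). Qed.

(* The Schur form T = U A U* over R[i], with U = X + i Y and T = S + i W. *)
Lemma real_schur n (A : 'M[R]_n) : (0 < n)%N ->
  exists X Y S W : 'M[R]_n,
  [/\ X^T *m X + Y^T *m Y = 1%:M, X *m X^T + Y *m Y^T = 1%:M,
      S = X *m A *m X^T + Y *m A *m Y^T, W = Y *m A *m X^T - X *m A *m Y^T &
   [/\ X *m A = S *m X - W *m Y, Y *m A = S *m Y + W *m X,
      forall i j : 'I_n, (i < j)%N -> S i j = 0 /\ W i j = 0 &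
      forall i, cspectrum A (Complex (S i i) (W i i))]].
Proof.
move=> n0; set Ac : 'M[R[i]]_n := map_mx (real_complex R) A.
have [U Uu tT] := @Schur _ n Ac n0.
pose T := conjmx U Ac; have {}tT : is_trig_mx T by [].
have TE : T = U *m Ac *m map_mx Num.conj U^T by rewrite /T conjymx.
have Tev (i : 'I_n) : cspectrum A (T i i).
  have Te : eigenvalue T (T i i).
    rewrite eigenvalue_root_char char_poly_trig // rootE horner_prod.
    by rewrite (bigD1 i) //= hornerXsubC subrr mul0r.
  have Us : stablemx U Ac by rewrite stablemx_unit // unitarymx_unit.
  have Uf : row_free U by rewrite row_free_unit unitarymx_unit.
  exact: (eigenvalue_conjmx Us Uf Te).
clearbody T.
have UU := unitarymxP Uu; have UU' := mulmx1C UU.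
have reUU := congr1 re UU; have reUU' := congr1 re UU'; have imUU' := congr1 im UU'.
rewrite re_mul re_adj im_adj mulmxN opprK re1 in reUU.
rewrite re_mul re_adj im_adj mulNmx opprK re1 in reUU'.
rewrite im_mul re_adj im_adj im1 mulNmx in imUU'.
have reT := congr1 re TE; have imT := congr1 im TE.
rewrite !re_mul !im_mul re_adj im_adj re_real im_real !mulmx0 subr0 add0r
  mulmxN opprK in reT.
rewrite !im_mul !re_mul re_adj im_adj re_real im_real !mulmx0 subr0 add0r
  mulmxN addrC in imT.
(* Imaginary part of the unitarity relation: [X^T Y] is symmetric. *)
have XY : (re U)^T *m im U = (im U)^T *m re U by apply/eqP; rewrite -subr_eq0 imUU'.
exists (re U), (im U), (re T), (im T); split.
- exact: reUU'.
- exact: reUU.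
- exact: reT.
- by rewrite imT addrC.
split.
(* Real part of [U A = T U]: inserting [X^T X + Y^T Y = 1] to the right of [X A], the cross terms
   cancel by [XY]. The imaginary part is treated likewise. *)
- rewrite {1}reT {1}imT -[LHS]mulmx1 -reUU' mulmxDr !mulmxDl !mulNmx opprB -!mulmxA XY.
  by rewrite addrACA subrr addr0.
- rewrite {1}reT {1}imT -[LHS]mulmx1 -reUU' mulmxDr !mulmxDl !mulNmx -!mulmxA XY.
  by rewrite [RHS]addrC addrA subrK.
- move=> i j ij; rewrite !mxE; have /is_trig_mxP -> // := tT.
- move=> i; rewrite !mxE.
  have -> : Complex (complex.Re (T i i)) (complex.Im (T i i)) = T i i by case: (T i i).
  exact: Tev.
Qed.

End RealSchur.

(** * The spectral abscissa of a Hurwitz matrix *)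

Section StabilityMargin.
Context {R : realType} {n : nat}.
Implicit Types (A : 'M[R]_n).

Lemma stability_margin_ge A z : hurwitz A -> cspectrum A z ->
  complex.Re z <= - stability_margin A.
Proof.
move=> hA Az; rewrite opprK; apply: ub_le_sup; last by exists z.
by exists 0 => _ [w Aw <-]; rewrite ltW // hA.
Qed.

(** Strict negativity of the real parts passes to the supremum because the spectrum is the finite
    set of roots of the characteristic polynomial. *)
Lemma stability_margin_gt0 A : (0 < n)%N -> hurwitz A -> 0 < stability_margin A.
Proof.
move=> n0 hA; rewrite oppr_gt0.
set Ac := map_mx (real_complex R) A.
have [r rE] := closed_field_poly_normal (char_poly Ac).
have spE z : cspectrum A z = (z \in r).
  rewrite /cspectrum /= eigenvalue_root_char rE.
  by rewrite (monicP (char_poly_monic _)) scale1r root_prod_XsubC.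
(* The start value -1 is an arbitrary negative number; it keeps the maximum negative. *)
pose M := \big[Order.max/(-1 : R)]_(z <- r) complex.Re z.
have M0 : M < 0.
  rewrite /M big_seq; elim/big_ind: _ => [|x y x0 y0|z zr]; first by rewrite ltrN10.
    by rewrite gt_max x0.
  by apply: hA; rewrite spE.
apply: le_lt_trans M0; apply: ge_sup.
  (* The spectrum is nonempty: it contains the first diagonal entry of the Schur form. *)
  have [X [Y [S [W [_ _ _ _ [_ _ _ T]]]]]] := real_schur _ A n0.
  by exists (S (Ordinal n0) (Ordinal n0)), (Complex (S (Ordinal n0) (Ordinal n0))
    (W (Ordinal n0) (Ordinal n0))); first exact: T.
move=> _ [z Az <-]; rewrite /M; rewrite spE in Az.
exact: (@le_bigmax_seq _ _ _ _ _ z xpredT).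
Qed.

End StabilityMargin.

Section GeometricSums.
Context {R : realFieldType}.
Implicit Types x : R.

Lemma geometric_sum_le x m : 0 <= x -> x < 1 ->
  \sum_(k < m) x ^+ k.+1 <= x / (1 - x).
Proof.
move=> x0 x1; have x1' : 0 < 1 - x by rewrite subr_gt0.
rewrite ler_pdivlMr // mulrC.
have -> : (1 - x) * (\sum_(k < m) x ^+ k.+1) = x * (1 - x ^+ m).
  elim: m => [|m IH]; first by rewrite big_ord0 expr0 subrr !mulr0.
  by rewrite big_ord_recr /= mulrDr IH exprS; ring.
by rewrite ler_piMr // lerBlDr lerDl exprn_ge0.
Qed.

(** Row sums of the strictly lower triangular kernel [x ^+ (i - j)]; [geometric_sum_above] treats
    its column sums. *)
Lemma geometric_sum_below x n (i : 'I_n) : 0 <= x -> x < 1 ->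
  \sum_(j < n | (j < i)%N) x ^+ (i - j) <= x / (1 - x).
Proof.
move=> x0 x1; apply: le_trans (geometric_sum_le _ i x0 x1).
rewrite (big_ord_narrow (ltnW (ltn_ord i))) /= (reindex_inj rev_ord_inj) /=.
rewrite le_eqVlt; apply/orP; left; apply/eqP; apply: eq_bigr => k _.
by rewrite subKn.
Qed.

Lemma geometric_sum_above x n (j : 'I_n) : 0 <= x -> x < 1 ->
  \sum_(i < n | (j < i)%N) x ^+ (i - j) <= x / (1 - x).
Proof.
move=> x0 x1; apply: le_trans (geometric_sum_le _ (n - j.+1) x0 x1).
rewrite -(big_geq_mkord j.+1 n xpredT (fun i => x ^+ (i - j))) -{1}[j.+1]add0n big_addn big_mkord.
rewrite le_eqVlt; apply/orP; left; apply/eqP; apply: eq_bigr => k _.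
by rewrite addnS subSn ?leq_addl // addnK.
Qed.

End GeometricSums.

(** * Complex inequalities written with pairs of real vectors *)

Section WeightedNorm.
Context {R : realType}.

Lemma dotp_pair_le {n} (x y u v : 'cV[R]_n) :
  (dotp x u + dotp y v) ^+ 2 <=
  (dotp x x + dotp y y) * (dotp u u + dotp v v).
Proof.
have E (a b c d : 'cV[R]_n) :
    dotp a b + dotp c d = dotp (col_mx a c) (col_mx b d).
  by rewrite /dotp tr_col_mx mul_row_col [in RHS]mxE.
by rewrite !E cauchy_schwarz.
Qed.

(** The two numbers are the real and imaginary parts of the sesquilinear form of [A] at the unit
    complex rows [i] and [j] of [X + i Y], so its modulus is at most the norm of [A]. *)
Lemma schur_entry_le {n} (A X Y : 'M[R]_n) i j :
  X *m X^T + Y *m Y^T = 1%:M ->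
  (X *m A *m X^T + Y *m A *m Y^T) i j ^+ 2 +
  (Y *m A *m X^T - X *m A *m Y^T) i j ^+ 2 <= opnorm A ^+ 2.
Proof.
move=> XY; pose x k := (row k X)^T; pose y k := (row k Y)^T.
have N k : dotp (x k) (x k) + dotp (y k) (y k) = 1.
  have /matrixP/(_ k k) := XY; rewrite !mxE eqxx mulr1n => <-.
  by rewrite !dotpE; congr (_ + _); apply: eq_bigr => l _; rewrite !mxE.
have E (M N0 : 'M[R]_n) : (M *m A *m N0^T) i j = dotp (row i M)^T (A *m (row j N0)^T).
  by rewrite /dotp trmxK mulmxA -!row_mul tr_row !mxE; apply: eq_bigr => l _; rewrite !mxE.
set S := (X in X ^+ 2 + _); set W := (X in _ + X ^+ 2).
have SE : S = dotp (x i) (A *m x j) + dotp (y i) (A *m y j) by rewrite /S mxE !E.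
have WE : W = dotp (y i) (A *m x j) - dotp (x i) (A *m y j).
  by rewrite /W mxE [X in _ + X]mxE !E.
set d := S ^+ 2 + W ^+ 2.
have d0 : 0 <= d by rewrite addr_ge0 ?sqr_ge0.
have [->|dn] := eqVneq d 0; first exact: sqr_ge0.
have dp : 0 < d by rewrite lt_neqAle eq_sym dn.
(* Row [i] is multiplied by the conjugate of [S + i W]: its pairing with the image of row [j]
   becomes the real number [d], and its squared norm is also [d]. *)
have := dotp_pair_le (S *: x i + W *: y i) (S *: y i - W *: x i) (A *m x j) (A *m y j).
rewrite !(dotpDl, dotpDr, dotpNl, dotpNr, dotpZl, dotpZr) (dotpC (y i) (x i)).
have -> : S * dotp (x i) (A *m x j) + W * dotp (y i) (A *m x j) +
   (S * dotp (y i) (A *m y j) - W * dotp (x i) (A *m y j)) = d.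
  have -> : d = S * (dotp (x i) (A *m x j) + dotp (y i) (A *m y j)) +
      W * (dotp (y i) (A *m x j) - dotp (x i) (A *m y j)).
    by rewrite -SE -WE.
  by ring.
set u := (X in _ <= X * _); have -> : u = d.
  rewrite /u /d -[RHS]mulr1 -(N i); ring.
move=> h; rewrite -(ler_pM2l dp) -expr2; apply: le_trans h _.
rewrite ler_pM2l // -[leRHS]mulr1 -(N j) mulrDr.
by rewrite lerD // dotp_mulmx_le.
Qed.

(** With [t = s + i w], [z = p + i q] and [z' = p' + i q'], the left side is twice the real part of
    [t z'] times the conjugate of [z]. It is at most [2 a |z| |z'|], and the weighted
    arithmetic-geometric mean inequality with free weight [c] concludes. *)
Lemma schur_pair_le (a s w c p q p' q' : R) : 0 <= a -> 0 < c ->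
  s ^+ 2 + w ^+ 2 <= a ^+ 2 ->
  2 * (s * (p * p' + q * q') + w * (q * p' - p * q')) <=
  a * (c * (p ^+ 2 + q ^+ 2) + c^-1 * (p' ^+ 2 + q' ^+ 2)).
Proof.
move=> a0 c0 swa.
set B := _ + _; set N := p ^+ 2 + q ^+ 2; set N' := p' ^+ 2 + q' ^+ 2.
have N0 : 0 <= N by rewrite addr_ge0 ?sqr_ge0.
have N0' : 0 <= N' by rewrite addr_ge0 ?sqr_ge0.
have rhs0 : 0 <= a * (c * N + c^-1 * N').
  by rewrite mulr_ge0 // addr_ge0 // mulr_ge0 // ?invr_ge0 ltW.
apply: le_trans (ler_norm _) _.
rewrite -(@ler_pXn2r _ 2) ?nnegrE // real_normK ?num_real //.
have B2 : B ^+ 2 <= a ^+ 2 * (N * N').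
  apply: (@le_trans _ _ ((s ^+ 2 + w ^+ 2) * (N * N'))).
    have -> : (s ^+ 2 + w ^+ 2) * (N * N') =
        B ^+ 2 + (s * (q * p' - p * q') - w * (p * p' + q * q')) ^+ 2.
      by rewrite /B /N /N'; ring.
    by rewrite lerDl sqr_ge0.
  by rewrite ler_wpM2r // mulr_ge0.
have : 0 <= a ^+ 2 * (c * N - c^-1 * N') ^+ 2 by rewrite mulr_ge0 ?sqr_ge0.
have -> : a ^+ 2 * (c * N - c^-1 * N') ^+ 2 =
  (a * (c * N + c^-1 * N')) ^+ 2 - 4 * (a ^+ 2 * (N * N')).
  by field; rewrite gt_eqF.
move=> h; rewrite exprMn; lra.
Qed.

End WeightedNorm.

Section LyapunovWeight.
Context {R : realType}.

(* In Schur coordinates the weights rho^(2(n-1-i)) make the strictly lower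
   triangular part contribute at most half of the stability margin. *)
Lemma lyapunov_weight n (A : 'M[R]_n) : (0 < n)%N -> hurwitz A ->
  let m := transient_gain A in
  exists Q : 'M[R]_n, [/\ Q^T = Q,
    forall u, dotp u u <= dotp u (Q *m u),
    forall u, dotp u (Q *m u) <= m ^+ 2 * dotp u u &
    forall u, 2 * dotp u (Q *m (A *m u)) <=
      - stability_margin A * dotp u (Q *m u)].
Proof.
move=> n0 hA /=.
set sg := stability_margin A; set a := opnorm A.
have sg0 : 0 < sg by exact: stability_margin_gt0.
have [X [Y [S [W [XXYY XXYY' SE WE [XA YA tSW spS]]]]]] := real_schur _ A n0.
have SWa i j : S i j ^+ 2 + W i j ^+ 2 <= a ^+ 2.
  by rewrite SE WE; exact: schur_entry_le.
have Sd i : S i i <= - sg by exact: stability_margin_ge hA (spS i).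
have a0 : 0 < a.
  rewrite lt_neqAle opnorm_ge0 andbT; apply/eqP => a00.
  have := SWa (Ordinal n0) (Ordinal n0); have := Sd (Ordinal n0).
  rewrite -a00 expr0n /=; set s := S _ _; set w := W _ _ => h1 h2.
  have := sqr_ge0 w; nra.
(* With [x = 1 / rho], the geometric series [x / (1 - x)] equals [sg / (4 a)], so row sums and
   column sums each cost [sg / 4]. *)
pose rho := 1 + 4 * a / sg.
have rho1 : 1 < rho by rewrite ltrDl divr_gt0 // mulr_gt0.
have rho0 : 0 < rho by exact: lt_trans ltr01 rho1.
pose x := rho^-1.
have x0 : 0 <= x by rewrite invr_ge0 ltW.
have x1 : x < 1 by rewrite invf_lt1.
have xs : a * (x / (1 - x)) = sg / 4.
  have r1 : rho - 1 != 0 by rewrite subr_eq0 gt_eqF.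
  have -> : x / (1 - x) = (rho - 1)^-1 by rewrite /x; field; rewrite r1 gt_eqF.
  rewrite /rho addrC addKr; field; by rewrite !gt_eqF.
(* The last weight is 1 and the first is [rho ^+ (2 * n.-1)], the square of the transient gain;
   these give the two comparisons of [Q] with the identity. *)
pose w (i : 'I_n) := rho ^+ (2 * (n.-1 - i)).
have w0 i : 0 < w i by rewrite exprn_gt0.
pose D := diag_mx (\row_i w i).
pose Q : 'M[R]_n := X^T *m D *m X + Y^T *m D *m Y.
have QE u v : dotp u (Q *m v) =
    \sum_i w i * ((X *m u) i 0 * (X *m v) i 0 + (Y *m u) i 0 * (Y *m v) i 0).
  rewrite /Q mulmxDl dotpDr -!mulmxA ![dotp u (_^T *m _)]dotp_mulmx !trmxK.
  rewrite !dotpE -big_split; apply: eq_bigr => i _ /=.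
  by rewrite /D !mul_diag_mx !mxE; ring.
pose N (u : 'cV[R]_n) i := (X *m u) i 0 ^+ 2 + (Y *m u) i 0 ^+ 2.
have N0 u i : 0 <= N u i by rewrite addr_ge0 ?sqr_ge0.
have QN u : dotp u (Q *m u) = \sum_i w i * N u i.
  by rewrite QE; apply: eq_bigr => i _; rewrite /N !expr2.
have sN u : dotp u u = \sum_i N u i.
  rewrite -{2}[u]mul1mx -XXYY mulmxDl dotpDr -!mulmxA.
  rewrite ![dotp u (_^T *m _)]dotp_mulmx !trmxK !dotpE -big_split.
  by apply: eq_bigr => i _; rewrite /N !expr2.
exists Q; split.
- rewrite /Q linearD /= !trmx_mul !trmxK /D !tr_diag_mx.
  by rewrite !mulmxA.
- move=> u; rewrite QN sN; apply: ler_sum => i _.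
  by rewrite ler_peMl // exprn_ege1 // ltW.
- move=> u; rewrite QN sN mulr_sumr; apply: ler_sum => i _.
  rewrite ler_wpM2r // /w /transient_gain -exprM mulnC ler_weXn2l //.
    by rewrite ltW.
  by rewrite leq_mul // leq_subr.
move=> u; rewrite QE QN.
set p := X *m u; set q := Y *m u.
have pA i : (X *m (A *m u)) i 0 = \sum_j (S i j * p j 0 - W i j * q j 0).
  by rewrite mulmxA XA mulmxBl -!mulmxA mxE [X in _ + X]mxE !mxE -sumrB.
have qA i : (Y *m (A *m u)) i 0 = \sum_j (S i j * q j 0 + W i j * p j 0).
  by rewrite mulmxA YA mulmxDl -!mulmxA !mxE -big_split.
pose B i j := 2 * (S i j * (p i 0 * p j 0 + q i 0 * q j 0) +
                  W i j * (q i 0 * p j 0 - p i 0 * q j 0)).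
pose V i := w i * N u i.
have V0 i : 0 <= V i by rewrite mulr_ge0 // ltW.
have -> : 2 * (\sum_i w i * (p i 0 * (X *m (A *m u)) i 0 + q i 0 * (Y *m (A *m u)) i 0))
    = \sum_i \sum_j w i * B i j.
  rewrite mulr_sumr; apply: eq_bigr => i _; rewrite pA qA !mulr_sumr -big_split.
  by rewrite !mulr_sumr; apply: eq_bigr => j _ /=; rewrite /B; ring.
have Bd i : w i * B i i <= - 2 * sg * V i.
  have -> : w i * B i i = 2 * S i i * V i by rewrite /B /V /N -/p -/q; ring.
  by rewrite ler_wpM2r //; have := Sd i; lra.
(* The free weight is [c = x ^+ (i - j)]. Since [w j = rho ^+ (2 * (i - j)) * w i], one has
   [w i / c = c * w j], so both terms carry the same summable factor. *)
have Bl (i j : 'I_n) : (j < i)%N -> w i * B i j <= a * (x ^+ (i - j) * V i + x ^+ (i - j) * V j).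
  move=> ji; have c0 : 0 < x ^+ (i - j) by rewrite exprn_gt0 // invr_gt0.
  have := schur_pair_le a _ _ _ (p i 0) (q i 0) (p j 0) (q j 0) (ltW a0) c0 (SWa i j).
  rewrite -/(B i j) -(ler_pM2l (w0 i)) => h; apply: le_trans h _.
  have -> : x ^+ (i - j) * V j = w i * ((x ^+ (i - j))^-1 * N u j).
    rewrite /V mulrA [RHS]mulrA; congr (_ * _).
    rewrite /w /x -exprVn invrK.
    have -> : (n.-1 - j = (n.-1 - i) + (i - j))%N.
      by rewrite addnBA ?(ltnW ji) // subnK // -ltnS prednK.
    rewrite mulnDr exprD (mul2n (i - j)) -addnn (exprD _ (i - j)) exprVn.
    by field; rewrite expf_neq0 // gt_eqF.
  by rewrite /V le_eqVlt; apply/orP; left; apply/eqP; rewrite /N -/p -/q; ring.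
have row_le (i : 'I_n) : \sum_j w i * B i j <= - 2 * sg * V i +
    \sum_(j < n | (j < i)%N) a * (x ^+ (i - j) * V i + x ^+ (i - j) * V j).
  rewrite (bigD1 i) //=; apply: lerD => //.
  rewrite (bigID (fun j : 'I_n => (j < i)%N)) /= [X in _ + X]big1 ?addr0.
    rewrite (eq_bigl (fun j : 'I_n => (j < i)%N)); last first.
      by move=> j; rewrite -val_eqE /= neq_ltn; case: ltngtP.
    by apply: ler_sum => j; exact: Bl.
  move=> j /andP[]; rewrite -val_eqE /= neq_ltn -leqNgt => /orP[ji|ij _].
    by rewrite leqNgt ji.
  by have [S0 W0] := tSW _ _ ij; rewrite /B S0 W0 !mul0r addr0 !mulr0.
apply: le_trans (ler_sum _ (fun i _ => row_le i)) _.
rewrite big_split /= -mulr_sumr.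
under eq_bigr do rewrite -mulr_sumr big_split /=.
rewrite -mulr_sumr big_split /= mulrDr.
(* The terms in [V j] are regrouped by column. *)
have -> : \sum_(i < n) \sum_(j < n | (j < i)%N) x ^+ (i - j) * V j =
   \sum_(j < n) \sum_(i < n | (j < i)%N) x ^+ (i - j) * V j.
  by rewrite (exchange_big_dep xpredT).
set T := \sum_i V i.
have h1 : a * (\sum_(i < n) \sum_(j < n | (j < i)%N) x ^+ (i - j) * V i) <= sg / 4 * T.
  rewrite -xs -mulrA ler_pM2l // /T mulr_sumr; apply: ler_sum => i _.
  by rewrite -mulr_suml ler_wpM2r // geometric_sum_below.
have h2 : a * (\sum_(j < n) \sum_(i < n | (j < i)%N) x ^+ (i - j) * V j) <= sg / 4 * T.
  rewrite -xs -mulrA ler_pM2l // /T mulr_sumr; apply: ler_sum => i _.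
  by rewrite -mulr_suml ler_wpM2r // geometric_sum_above.
have T0 : 0 <= sg * T by rewrite mulr_ge0 ?sumr_ge0 // ltW.
lra.
Qed.

End LyapunovWeight.

(** * Bounds on the solution of the Lyapunov equation *)

Section LyapunovEquation.
Context {R : realType} {n : nat}.
Hypothesis n_gt0 : (0 < n)%N.
Implicit Types (u v : 'cV[R]_n) (A : 'M[R]_n).

Let posdef1 : posdef (1%:M : 'M[R]_n).
Proof. by move=> v v0; rewrite mul1mx dotp_gt0. Qed.

(** Only the symmetric part of [A] contributes to the form, and its Rayleigh quotient has the least
    eigenvalue as minimum, found by [pencil_max] for the opposite matrix. *)
Lemma sym_margin_le A u : - sym_margin A * dotp u u <= dotp u (A *m u).
Proof.
pose S : 'M[R]_n := 2^-1 *: (A + A^T).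
have SE v : dotp v (S *m v) = dotp v (A *m v).
  rewrite /S -scalemxAl mulmxDl dotpZr dotpDr (dotp_mulmx A^T) trmxK.
  by rewrite (dotpC (A *m v)); field.
have sS : S^T = S by rewrite /S linearZ linearD /= trmxK addrC.
have [||l [v [v0 Sv hl]]] := pencil_max (- S) 1%:M n_gt0 _ _ posdef1.
- by rewrite linearN /= sS.
- exact: trmx1.
have {}hl w : - l * dotp w w <= dotp w (S *m w).
  by have := hl w; rewrite mul1mx mulNmx dotpNr; lra.
rewrite -SE; apply: le_trans (hl u); rewrite ler_wpM2r ?dotp_ge0 // opprK.
apply: ge_inf.
  (* A lower bound of the eigenvalues is needed for the infimum to be meaningful. Eigenvectors are
     rows here, hence the transpositions. *)
  exists (- l) => y /= /eigenvalueP[z zS z0].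
  have zT0 : z^T != 0.
    by apply: contra z0 => /eqP /(congr1 trmx); rewrite trmxK trmx0 => ->.
  rewrite -(ler_pM2r (_ : 0 < dotp z^T z^T)) ?dotp_gt0 //.
  apply: le_trans (hl _) _.
  suff -> : S *m z^T = y *: z^T by rewrite dotpZr.
  by rewrite -[S]sS -trmx_mul zS linearZ.
rewrite /=; apply/eigenvalueP; exists v^T.
  rewrite -/S -{1}[S]sS -trmx_mul.
  suff -> : S *m v = - l *: v by rewrite linearZ.
  by rewrite scaleNr -[l *: v]/(l *: v) -{2}[v]mul1mx -Sv mulNmx opprK.
by apply: contra v0 => /eqP /(congr1 trmx); rewrite trmxK trmx0 => ->.
Qed.

Section Solution.
Variables (A P : 'M[R]_n) (ell : R).
Hypotheses (hA : hurwitz A) (ell_ge0 : 0 <= ell).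
Hypotheses (sP : P^T = P) (pP : posdef P).
Hypothesis lyapP : (A - ell%:M)^T *m P + P *m (A - ell%:M) = - 1%:M.

(** The Lyapunov equation as a quadratic form. It serves at eigenvectors to bound [P], and along
    trajectories to compute the derivative of [V]. *)
Lemma lyapunov_dotp u : 2 * dotp (P *m u) ((A - ell%:M) *m u) = - dotp u u.
Proof.
have := congr1 (fun M : 'M[R]_n => dotp u (M *m u)) lyapP.
rewrite mulmxDl mulNmx mul1mx dotpDr dotpNr -!mulmxA (dotp_mulmx _^T) trmxK.
by rewrite (dotp_mulmx P u) sP (dotpC (_ *m u) (P *m u)) => <-; ring.
Qed.

Let shiftE u v : dotp u ((A - ell%:M) *m v) = dotp u (A *m v) - ell * dotp u v.
Proof. by rewrite mulmxBl mul_scalar_mx dotpBr dotpZr. Qed.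

(** At the top eigenvector, [P v = l Q v] and the Lyapunov equation give [l (sigma + 2 ell) <v, Q v>
    <= |v|^2 <= <v, Q v>]. Hence [l <= 1 / (sigma + 2 ell)], and [P <= l Q] with [Q <= m^2]. *)
Lemma lyapunov_upper u :
  dotp u (P *m u) <=
  transient_gain A ^+ 2 / (stability_margin A + 2 * ell) * dotp u u.
Proof.
have sg0 : 0 < stability_margin A + 2 * ell.
  by rewrite ltr_pwDl ?mulr_ge0 // stability_margin_gt0.
have [Q [sQ Q1 Qm QA]] := lyapunov_weight _ A n_gt0 hA.
have pQ : posdef Q by move=> v v0; apply: lt_le_trans (Q1 v); rewrite dotp_gt0.
have [l [v [v0 Pv hl]]] := pencil_max P Q n_gt0 sP sQ pQ.
have Qv0 := pQ v v0.
have l0 : 0 < l.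
  by have := pP v v0; rewrite Pv dotpZr pmulr_lgt0.
have l1 : l <= (stability_margin A + 2 * ell)^-1.
  rewrite -[leRHS]mul1r ler_pdivlMr // -(ler_pM2r Qv0) mul1r.
  apply: le_trans (Q1 v).
  have := lyapunov_dotp v; rewrite Pv dotpZl shiftE.
  have := QA v; rewrite (dotp_mulmx Q v (A *m v)) sQ (dotpC v (Q *m v)).
  by rewrite -(ler_pM2l l0); lra.
apply: le_trans (hl u) _; rewrite mulrAC [leRHS]mulrC.
by apply: ler_pM => //; [exact: ltW | exact: le_trans (dotp_ge0 u) (Q1 u)].
Qed.

(** For the least eigenvalue [k = - l] of [P], the Lyapunov equation at its eigenvector gives
    [|v|^2 <= 2 k (s + ell) |v|^2], so [1 <= 2 k (s + ell)], while [P >= k]. *)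
Lemma lyapunov_lower u :
  dotp u u <= 2 * (sym_margin A + ell) * dotp u (P *m u).
Proof.
have [||l [v [v0 Pv hl]]] := pencil_max (- P) 1%:M n_gt0 _ _ posdef1.
- by rewrite linearN /= sP.
- exact: trmx1.
have {}Pv : P *m v = - l *: v by rewrite -[P]opprK mulNmx Pv mul1mx scaleNr.
have vp : 0 < dotp v v by rewrite dotp_gt0.
have k0 : 0 < - l by have := pP v v0; rewrite Pv dotpZr pmulr_lgt0.
have k1 : 1 <= 2 * (sym_margin A + ell) * - l.
  rewrite -(ler_pM2r vp) mul1r.
  have := lyapunov_dotp v; rewrite Pv dotpZl shiftE.
  by have := sym_margin_le A v; move/(ler_wpM2l (ltW k0)); lra.
have s0 : 0 <= 2 * (sym_margin A + ell).
  by rewrite -(pmulr_lge0 _ k0); exact: le_trans ler01 k1.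
have := hl u; rewrite mul1mx mulNmx dotpNr => hu.
have h1 : 0 <= 2 * (sym_margin A + ell) * (dotp u (P *m u) + l * dotp u u).
  by rewrite mulr_ge0 //; lra.
have h2 : 0 <= (2 * (sym_margin A + ell) * - l - 1) * dotp u u.
  by rewrite mulr_ge0 ?dotp_ge0 // subr_ge0.
lra.
Qed.

(** Read off [lyapunov_lower] at one nonzero vector; it makes [beta1] positive. *)
Lemma sym_margin_shift_gt0 : 0 < sym_margin A + ell.
Proof.
pose u : 'cV[R]_n := delta_mx (Ordinal n_gt0) 0.
have u0 : u != 0.
  apply/eqP => /matrixP /(_ (Ordinal n_gt0) 0).
  by rewrite !mxE !eqxx => /eqP; rewrite oner_eq0.
have := lyapunov_lower u; have := pP u u0.
have : 0 < dotp u u by rewrite dotp_gt0.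
move=> u1 u2 u3; have := lt_le_trans u1 u3.
by rewrite pmulr_lgt0 // pmulr_rgt0.
Qed.

End Solution.
End LyapunovEquation.

(** * The projection operator *)

Section Projection.
Context {R : realType} {n : nat}.
Variables (vth eps gamma : R).
Hypotheses (vth_gt0 : 0 < vth) (eps_gt0 : 0 < eps) (gamma_gt0 : 0 < gamma).
Implicit Types (th y ths : 'cV[R]_n).

Let k := 2 * eps * vth + eps ^+ 2.
Let k_gt0 : 0 < k.
Proof. by rewrite addr_gt0 ?exprn_gt0 // !mulr_gt0. Qed.

Let f := @proj_bound R n vth eps.
Let Proj th y := Defs.proj (gamma%:M : 'M[R]_n) th y f.

Let fE th : f th = (dotp th th - vth ^+ 2) / k.
Proof. by rewrite /f /proj_bound sqr_enorm. Qed.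

Lemma grad_proj_bound th : grad (proj_bound vth eps) th = (2 / k) *: th.
Proof.
apply/matrixP => i j; rewrite !mxE ord1 -/f.
apply/cvg_lim => //.
(* The difference quotient in direction [i] is exactly this affine function of [h]. *)
have lim : (2 * th i 0 + h) / k @[h --> 0^'] --> 2 / k * th i 0.
  have -> : 2 / k * th i 0 = (2 * th i 0 + 0) / k by rewrite addr0; ring.
  apply: cvg_within_filter.
  by apply: cvgM; [apply: cvgD; [exact: cvg_cst|exact: cvg_id]|exact: cvg_cst].
apply: cvg_trans lim; apply: near_eq_cvg; near=> h.
have h0 : h != 0 by near: h; exact: nbhs_dnbhs_neq.
rewrite /= !fE !(dotpDl, dotpDr, dotpZl, dotpZr).
have d1 : dotp (delta_mx i 0) (delta_mx i 0) = 1 :> R.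
  rewrite dotpE (bigD1 i) //= mxE !eqxx mulr1 big1 ?addr0 // => l li.
  by rewrite mxE (negbTE li) mul0r.
have d2 : dotp (delta_mx i 0) th = th i 0.
  rewrite dotpE (bigD1 i) //= mxE !eqxx mul1r big1 ?addr0 // => l li.
  by rewrite mxE (negbTE li) mul0r.
rewrite (dotpC th) d1 d2 /GRing.scale /=; field.
by rewrite h0 gt_eqF.
Unshelve. all: by end_near. Qed.

(* The positive parts and the cut-off [vth ^+ 2] make the continuity of the
   projection visible, which the case distinction in [proj] hides. *)
Lemma projE th y : Proj th y = gamma *: (y - (Num.max (f th) 0 *
  Num.max (dotp th y) 0 / Num.max (dotp th th) (vth ^+ 2)) *: th).
Proof.
rewrite /Proj /Defs.proj grad_proj_bound -/f !mul_scalar_mx dotpZr dotpZr dotpC.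
have k2 : 0 < 2 / k by rewrite divr_gt0.
rewrite (pmulr_rgt0 _ gamma_gt0) dotpZl (pmulr_rgt0 _ k2).
have [f0|f0] /= := ltP 0 (f th); last by rewrite mul0r mul0r scale0r subr0.
have [d0|d0] /= := ltP 0 (dotp th y); last by rewrite mulr0 mul0r scale0r subr0.
have t0 : vth ^+ 2 < dotp th th.
  by move: f0; rewrite fE pmulr_lgt0 ?invr_gt0 // subr_gt0.
have tp : 0 < dotp th th by apply: lt_trans t0; rewrite exprn_gt0.
rewrite (max_l (ltW t0)) scalerBr; congr (_ - _).
rewrite [((2 / k) *: th)^T]linearZ /=.
rewrite -!scalemxAl -!scalemxAr -!scalemxAl -!mulmxA.
rewrite [th^T *m y]mx11_scalar -/(dotp th y).
rewrite mul_mx_scalar !scalerA !dotpZl !dotpZr; congr (_ *: _).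
by field; rewrite !gt_eqF.
Qed.

(** The projection subtracts a nonnegative multiple of [th], nonzero only when [|th| > vth]; there
    [<th - ths, th> >= 0] by Cauchy-Schwarz, since [|ths| <= vth]. *)
Lemma proj_convex ths th y : enorm ths <= vth ->
  dotp (th - ths) (Proj th y) <= gamma * dotp (th - ths) y.
Proof.
move=> hs; rewrite projE dotpZr ler_pM2l // dotpBr dotpZr lerBlDr lerDl.
have [f0|f0] := ltP 0 (f th); last by rewrite !mul0r.
have t0 : vth ^+ 2 < dotp th th.
  by move: f0; rewrite fE pmulr_lgt0 ?invr_gt0 // subr_gt0.
rewrite mulr_ge0 //.
  apply: divr_ge0; last by rewrite le_max sqr_ge0 orbT.
  by apply: mulr_ge0; [exact: ltW f0 | rewrite le_max lexx orbT].
rewrite dotpBl subr_ge0; apply: le_trans (ler_dotp _ _) _.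
rewrite -sqr_enorm expr2 ler_wpM2r ?enorm_ge0 //; apply: le_trans hs _.
have : vth ^+ 2 <= enorm th ^+ 2 by rewrite sqr_enorm ltW.
by rewrite ler_pXn2r // nnegrE ?enorm_ge0 ?ltW.
Qed.

(** Here [f th >= 1], so an outward radial component of [y] is removed at least entirely. *)
Lemma proj_inward th y : (vth + eps) ^+ 2 <= dotp th th ->
  dotp th (Proj th y) <= 0.
Proof.
move=> ht; rewrite projE dotpZr pmulr_rle0 // dotpBr dotpZr subr_le0.
have f1 : 1 <= f th.
  rewrite fE ler_pdivlMr // mul1r /k; move: ht; rewrite sqrrD; lra.
have t0 : vth ^+ 2 < dotp th th.
  apply: lt_le_trans ht; rewrite ltr_pXn2r // ?nnegrE ?addr_ge0 ?ltW //.
  by rewrite ltrDl.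
have tp : 0 < dotp th th by apply: lt_trans t0; rewrite exprn_gt0.
rewrite (max_l (ltW t0)) (max_l (le_trans ler01 f1)) divfK ?gt_eqF //.
apply: (@le_trans _ _ (Num.max (dotp th y) 0)); first by rewrite le_max lexx.
by rewrite ler_peMl // le_max lexx orbT.
Qed.

Lemma cvg_maxr (T : Type) (F : set_system T) {FF : Filter F} (g h : T -> R) a b :
  g x @[x --> F] --> a -> h x @[x --> F] --> b ->
  Num.max (g x) (h x) @[x --> F] --> Num.max a b.
Proof.
have E (u v : R) : Num.max u v = (u + v + `|u - v|) / 2.
  by have [uv|uv] := leP u v; [rewrite ler0_norm|rewrite gtr0_norm]; lra.
move=> ga hb; rewrite E; under eq_cvg do rewrite E.
apply: cvgM; last exact: cvg_cst.
by apply: cvgD; [exact: cvgD | apply: cvg_norm; exact: cvgB].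
Qed.

(** In the form [projE] everything is continuous, the denominator being at least [vth ^+ 2 > 0]. *)
Lemma cvg_proj (T : Type) (F : set_system T) {FF : Filter F}
    (g h : T -> 'cV[R]_n) th y :
  (forall i, g x i 0 @[x --> F] --> th i 0) ->
  (forall i, h x i 0 @[x --> F] --> y i 0) ->
  forall i, Defs.proj (gamma%:M : 'M[R]_n) (g x) (h x) f i 0 @[x --> F] -->
    Defs.proj (gamma%:M : 'M[R]_n) th y f i 0.
Proof.
move=> gth hy i.
have E th0 y0 : Defs.proj (gamma%:M : 'M[R]_n) th0 y0 f i 0 = gamma * (y0 i 0 -
    Num.max ((dotp th0 th0 - vth ^+ 2) / k) 0 * Num.max (dotp th0 y0) 0 /
    Num.max (dotp th0 th0) (vth ^+ 2) * th0 i 0).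
  by rewrite -/(Proj _ _) projE !mxE fE.
rewrite E; under eq_cvg do rewrite E.
have cc (c : R) : (fun _ : T => c) @ F --> c by exact: cvg_cst.
have tt := cvg_dotp _ _ _ _ _ _ gth gth; have ty := cvg_dotp _ _ _ _ _ _ gth hy.
apply: cvgM; first exact: cc.
apply: cvgB; first exact: hy.
apply: cvgM; last exact: gth.
apply: cvgM.
  apply: cvgM; apply: cvg_maxr; [|exact: cc|exact: ty|exact: cc].
  by apply: cvgM; [apply: cvgB; [exact: tt|exact: cc]|exact: cc].
apply: cvgV; last by apply: cvg_maxr; [exact: tt|exact: cc].
by rewrite gt_eqF // lt_max exprn_gt0 ?orbT.
Qed.

End Projection.

(** * Integral equations and differential inequalities *)

Section IntegralEquation.
Context {R : realType}.
Notation mu := (@lebesgue_measure R).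
Implicit Types (F z : R -> R) (t s : R).

Lemma integral_equation_continuous F z t1 : 0 <= t1 ->
  mu.-integrable `[0, t1] (EFin \o F) ->
  (forall t, t \in `[0, t1] -> z t = z 0 + (\int[mu]_(s in `[0, t]) F s)%R) ->
  {within `[0, t1], continuous z}.
Proof.
move=> t10 iF zE; apply/subspace_continuousP => t tI.
have /subspace_continuousP/(_ t tI) h := parameterized_integral_continuous t10 iF.
have {}h : (fun s => z 0 + parameterized_integral mu 0 s F) @
    within `[0, t1] (nbhs t) --> z t.
  rewrite (zE t) //; apply: (@cvgD _ _ _ (within `[0, t1] (nbhs t))).
    exact: cvg_cst.
  exact: h.
apply: cvg_trans h; apply: near_eq_cvg.
near=> s; rewrite [RHS](zE s) //.
by near: s; apply: withinT; exact: nbhs_filter.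
Unshelve. all: by end_near. Qed.

(* A solution on a segment is extended past both end points by freezing the
   right-hand side, which makes it two-sidedly differentiable on the segment. *)
Lemma integral_equation_extension F z t1 : 0 < t1 ->
  {within `[0, t1], continuous F} ->
  (forall t, t \in `[0, t1] -> z t = z 0 + (\int[mu]_(s in `[0, t]) F s)%R) ->
  exists zt, (forall t, t \in `[0, t1] -> zt t = z t) /\
    (forall t, t \in `[0, t1] -> is_derive t (1 : R) zt (F t)).
Proof.
move=> t10 /subspace_continuousP cF zE.
(* The clamping of [s] to [[0, t1]], with the minimum written through a maximum so that [cvg_maxr]
   yields continuity. *)
pose c s : R := Num.max 0 (- Num.max (- s) (- t1)).
have cI s : `[0, t1]%classic (c s).
  rewrite /= in_itv /= /c le_max lexx /= ge_max (ltW t10) /= lerNl.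
  by rewrite le_max lexx orbT.
have cid t : t \in `[0, t1] -> c t = t.
  rewrite in_itv /= => /andP[t0 tt1]; rewrite /c.
  by rewrite (@max_l _ _ (- t)) ?lerN2 // opprK max_r.
pose G := F \o c.
have cc s : c x @[x --> s] --> c s.
  apply: cvg_maxr; first exact: cvg_cst.
  by apply: cvgN; apply: cvg_maxr; [apply: cvgN; exact: cvg_id | exact: cvg_cst].
have cG s : {for s, continuous G}.
  apply: (@cvg_comp _ _ _ c F (nbhs s) (within `[0, t1] (nbhs (c s)))); last exact: cF.
  move=> P wP.
  have : nbhs s [set x | `[0, t1]%classic (c x) -> P (c x)] := cc s _ wP.
  by apply: filterS => x; apply; exact: cI.
have iG a b : mu.-integrable `[a, b] (EFin \o G).
  apply: continuous_compact_integrable; first exact: segment_compact.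
  by apply: continuous_subspaceT => s; exact: cG.
have GF t : t \in `[0, t1] -> \int[mu]_(s in `[0, t]) G s = \int[mu]_(s in `[0, t]) F s.
  rewrite in_itv /= => /andP[t0 tt1]; apply: eq_Rintegral => s.
  rewrite inE /= in_itv /= => /andP[s0 st]; rewrite /G /= cid // in_itv /= s0.
  exact: le_trans st tt1.
(* Integration starts at -1 so that 0 becomes an interior point; the constant compensates for the
   integral over [[-1, 0]]. *)
exists (fun t => z 0 - \int[mu]_(s in `[-1, 0]) G s + \int[mu]_(s in `[-1, t]) G s).
split=> t tI; have := tI; rewrite in_itv /= => /andP[t0 tt1].
- rewrite (zE t tI) -(GF t tI) -addrA; congr (_ + _).
  rewrite addrC Rintegral_itvB //; last by rewrite bnd_simp.
  rewrite Rintegral_itv_obnd_cbnd //.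
  by apply: integrableS (iG 0 t) => //; apply: subset_itvr; rewrite bnd_simp.
- have t11 : t < t + 1 by rewrite ltrDl.
  have t1N : -1 < t by lra.
  have [dG G't] := continuous_FTC1_closed t11 (iG (-1) (t + 1)) t1N (cG t).
  have := DeriveDef dG erefl; rewrite -derive1E G't /G /= cid // => dH.
  have -> : F t = 0 + F t by rewrite add0r.
  exact: is_deriveD.
Qed.

End IntegralEquation.

(** * Monotonicity, barriers and exponential decay *)

Section DifferentialInequalities.
Context {R : realType}.
Implicit Types (h dh : R -> R) (t s : R).

Lemma is_derive_within_continuous h dh (D : set R) :
  (forall t, D t -> is_derive t (1 : R) h (dh t)) -> {within D, continuous h}.
Proof.
move=> hd; apply/continuous_in_subspaceT => t /set_mem Dt.
by have [dt _] := hd t Dt; apply/differentiable_continuous; rewrite -derivable1_diffP.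
Qed.

(** Mean value theorem. The sign of [dh] is asked only in the open interval, which is where
    [barrier] can supply it. *)
Lemma is_derive_le0_noninc h dh a b : a <= b ->
  (forall t, t \in `[a, b] -> is_derive t (1 : R) h (dh t)) ->
  (forall t, t \in `]a, b[ -> dh t <= 0) -> h b <= h a.
Proof.
rewrite le_eqVlt => /predU1P[-> //|ab] hd dh0.
have sub t : t \in `]a, b[ -> t \in `[a, b] by apply: subset_itv_oo_cc.
have hd' t : t \in `]a, b[ -> is_derive t (1 : R) h (dh t) by move=> tab; exact/hd/sub.
have hc : {within `[a, b], continuous h}.
  by apply: (@is_derive_within_continuous h dh) => t tab; exact: hd.
have [c cab E] := MVT ab hd' hc.
by rewrite -subr_le0 E mulr_le0_ge0 ?dh0 // subr_ge0 ltW.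
Qed.

(** If [h t > c], then after the last earlier time with [h <= c] the function stays above [c], hence
    does not increase, which is a contradiction. *)
Lemma barrier h dh t1 c :
  (forall t, t \in `[0, t1] -> is_derive t (1 : R) h (dh t)) ->
  (forall t, t \in `[0, t1] -> c <= h t -> dh t <= 0) ->
  h 0 <= c -> forall t, t \in `[0, t1] -> h t <= c.
Proof.
move=> hd dh0 h0 t tI; rewrite leNgt; apply/negP => ht.
have := tI; rewrite in_itv /= => /andP[t0 tt1].
pose S := [set s | s \in `[0, t] /\ h s <= c].
have S0 : S 0 by split=> //; rewrite in_itv /= lexx t0.
have Sub : has_ubound S by exists t => s [] /=; rewrite in_itv /= => /andP[].
have ps : 0 <= sup S by apply: ub_le_sup.
have st : sup S <= t.
  by apply: ge_sup; [exists 0|move=> s []; rewrite in_itv /= => /andP[]].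
have inI s : s \in `[0, t] -> s \in `[0, t1].
  by rewrite !in_itv /= => /andP[-> /= /le_trans->].
have hcont s : s \in `[0, t1] -> {for s, continuous h}.
  by move=> /hd[dt _]; apply/differentiable_continuous; rewrite -derivable1_diffP.
have sI : sup S \in `[0, t1] by rewrite inI // in_itv /= ps.
(* The supremum belongs to [S]: otherwise [h > c] near it by continuity, although points of [S] come
   arbitrarily close. *)
have hs : h (sup S) <= c.
  rewrite leNgt; apply/negP => hsc.
  have /(_ [set y | c < y]) := hcont _ sI.
  case; first by apply: open_nbhs_nbhs; split=> //; exact: open_gt.
  move=> d /= d0 dS.
  have [s [sI' sc] ds] := sup_adherent d0 (conj (ex_intro _ 0 S0) Sub).
  have := dS s; rewrite /= ger0_norm ?subr_ge0; last exact: ub_le_sup.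
  by rewrite ltrBlDr -ltrBlDl => /(_ ds); rewrite ltNge sc.
have d1 s : s \in `[sup S, t] -> is_derive s (1 : R) h (dh s).
  rewrite in_itv /= => /andP[ss1 ss2]; apply/hd/inI.
  by rewrite in_itv /= ss2 (le_trans ps).
have d2 s : s \in `]sup S, t[ -> dh s <= 0.
  rewrite in_itv /= => /andP[ss1 ss2].
  have sI2 : s \in `[0, t] by rewrite in_itv /= (ltW ss2) (le_trans ps (ltW ss1)).
  apply: dh0; first exact: inI.
  rewrite leNgt; apply/negP => hsc.
  by have := ub_le_sup Sub (conj sI2 (ltW hsc)); rewrite leNgt ss1.
have := le_trans (is_derive_le0_noninc _ _ _ _ st d1 d2) hs.
by rewrite leNgt ht.
Qed.

(** With the integrating factor [expR (a * t)], the product is nonincreasing. *)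
Lemma exp_decay h dh t1 a :
  (forall t, t \in `[0, t1] -> is_derive t (1 : R) h (dh t)) ->
  (forall t, t \in `[0, t1] -> dh t <= - a * h t) ->
  forall t, t \in `[0, t1] -> h t <= h 0 * expR (- a * t).
Proof.
move=> hd dha t tI; have := tI; rewrite in_itv /= => /andP[t0 tt1].
have E0 s : 0 < expR (a * s) by exact: expR_gt0.
have dE s : is_derive s (1 : R) (fun s => expR (a * s)) (a * expR (a * s)).
  have -> : (fun s => expR (a * s)) = expR \o (a \*: (id : R -> R)) by [].
  apply: is_derive_eq; rewrite /= /GRing.scale /=; ring.
have sub s : s \in `[0, t] -> s \in `[0, t1].
  by rewrite !in_itv /= => /andP[-> /= /le_trans->].
pose k s := h s * expR (a * s).
pose dk s := h s * (a * expR (a * s)) + expR (a * s) * dh s.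
have d1 s : s \in `[0, t] -> is_derive s (1 : R) k (dk s).
  by move=> /sub /hd ds; exact: is_deriveM.
have d2 s : s \in `]0, t[ -> dk s <= 0.
  move=> /subset_itv_oo_cc /sub /dha; rewrite /dk -(ler_pM2l (E0 s)); lra.
have := is_derive_le0_noninc _ _ _ _ t0 d1 d2.
rewrite /k mulr0 expR0 mulr1 mulNr expRN => hk.
by rewrite -ler_pdivrMr ?invr_gt0 // invrK.
Qed.

Lemma has_derivative_within_extension (D : set R) h g t t1 l :
  (forall s, D s -> 0 <= s) -> 0 <= t -> t < t1 ->
  (forall s, s \in `[0, t1] -> g s = h s) ->
  is_derive t (1 : R) g l -> has_derivative_within D h t l.
Proof.
move=> D0 t0 tt1 gh [/cvg_ex[/= l' dg] gl].
have {gl dg} dg : s^-1 *: (g (s *: 1 + t) - g t) @[s --> 0^'] --> l.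
  by rewrite -gl; have := dg; rewrite -(cvg_lim _ dg).
apply/cvgrPdist_lt => e e0.
have /cvgrPdist_lt/(_ e e0) [d /= d0 dS] := dg.
(* The second radius keeps the nearby points below [t1], where [g] and [h] agree. *)
exists (Num.min d (t1 - t)); first by rewrite /= lt_min d0 subr_gt0.
move=> s /=; rewrite lt_min => /andP[sd st1] st Ds.
have s1 : s <= t1 by move: st1; rewrite distrC => /(le_lt_trans (ler_norm _)); lra.
rewrite -!gh ?in_itv /= ?t0 ?(D0 s) ?(ltW tt1) //.
have := dS (s - t); rewrite /= sub0r normrN distrC => /(_ sd).
rewrite subr_eq0 => /(_ st); rewrite /GRing.scale /= mulr1 subrK mulrC.
by [].
Qed.

End DifferentialInequalities.

(** * Derivatives and integral equations for vector trajectories *)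

Section VectorCalculus.
Context {R : realType} {n : nat}.
Implicit Types (f g : R -> 'cV[R]_n) (t : R).

Lemma is_derive_dotp f g (f' g' : 'cV[R]_n) t :
  (forall i, is_derive t (1 : R) (fun s => f s i 0) (f' i 0)) ->
  (forall i, is_derive t (1 : R) (fun s => g s i 0) (g' i 0)) ->
  is_derive t (1 : R) (fun s => dotp (f s) (g s)) (dotp f' (g t) + dotp (f t) g').
Proof.
move=> df dg.
have -> : (fun s => dotp (f s) (g s)) =
    \sum_(i < n) (fun s => f s i 0) * (fun s => g s i 0).
  by apply/funext => s; rewrite fct_sumE dotpE.
have -> : dotp f' (g t) + dotp (f t) g' =
    \sum_(i < n) (f t i 0 *: g' i 0 + g t i 0 *: f' i 0).
  rewrite !dotpE -big_split; apply: eq_bigr => i _ /=.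
  by rewrite /GRing.scale /= addrC [g t i 0 * _]mulrC.
by apply: is_derive_sum => i; exact: is_deriveM.
Qed.

Lemma is_derive_mulmx (A : 'M[R]_n) f (f' : 'cV[R]_n) t :
  (forall i, is_derive t (1 : R) (fun s => f s i 0) (f' i 0)) ->
  forall i, is_derive t (1 : R) (fun s => (A *m f s) i 0) ((A *m f') i 0).
Proof.
move=> df i.
have -> : (fun s => (A *m f s) i 0) = \sum_(j < n) (A i j \*: (fun s => f s j 0)).
  by apply/funext => s; rewrite fct_sumE mxE.
by rewrite mxE; apply: is_derive_sum => j; exact: is_deriveZ.
Qed.

Lemma solvesB (T : \bar R) (x y F G : R -> 'cV[R]_n) :
  solves T x F -> solves T y G ->
  solves T (fun t => x t - y t) (fun t => F t - G t).
Proof.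
move=> xF yG t Tt i; have [iF xE] := xF t Tt i; have [iG yE] := yG t Tt i.
split.
  rewrite (_ : (fun s => _) = (fun s => (F s i 0)%:E - (G s i 0)%:E)%E).
    exact: integrableB.
  by apply/funext => s; rewrite !mxE EFinB.
have E : (fun s => (F s - G s) i 0) = (fun s => F s i 0 - G s i 0).
  by apply/funext => s; rewrite !mxE.
rewrite E RintegralB // !mxE xE yE; ring.
Qed.

Lemma solves_continuous (T : \bar R) (z F : R -> 'cV[R]_n) t1 :
  0 <= t1 -> times T t1 -> solves T z F ->
  forall i, {within `[0, t1], continuous (fun t => z t i 0)}.
Proof.
move=> t10 [_ Tt1] zF i; apply: (@integral_equation_continuous _ (fun t => F t i 0)) => //.
  by have [] := zF t1 (conj t10 Tt1) i.
move=> t; rewrite in_itv /= => /andP[t0 tt1].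
by have [|_ ->] := zF t _ i; first by split=> //; apply: le_lt_trans Tt1; rewrite lee_fin.
Qed.

Lemma solves_extension (T : \bar R) (z F : R -> 'cV[R]_n) t1 :
  0 < t1 -> times T t1 -> solves T z F ->
  (forall i, {within `[0, t1], continuous (fun t => F t i 0)}) ->
  exists zt : R -> 'cV[R]_n, (forall t, t \in `[0, t1] -> zt t = z t) /\
    (forall t, t \in `[0, t1] -> forall i,
      is_derive t (1 : R) (fun s => zt s i 0) (F t i 0)).
Proof.
move=> t10 [_ Tt1] zF cF.
have /choice[zt ztP] : forall i, exists zt : R -> R,
    (forall t, t \in `[0, t1] -> zt t = z t i 0) /\
    (forall t, t \in `[0, t1] -> is_derive t (1 : R) zt (F t i 0)).
  move=> i; apply: (@integral_equation_extension _ (fun t => F t i 0)) => //.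
  move=> t; rewrite in_itv /= => /andP[t0 tt1].
  by have [|_ ->] := zF t _ i; first by split=> //; apply: le_lt_trans Tt1; rewrite lee_fin.
exists (fun t => \col_i zt i t); split=> t tI.
  by apply/matrixP => i j; rewrite !mxE ord1 (ztP i).1.
move=> i; have -> : (fun s => (\col_i zt i s) i 0) = zt i.
  by apply/funext => s; rewrite mxE.
exact: (ztP i).2.
Qed.

End VectorCalculus.

(** * The closed loop *)

Section ClosedLoop.
Context {R : realType} {n : nat}.
Variables (Ap Am P : 'M[R]_n) (b ths : 'cV[R]_n) (r : R -> R).
Variables (ell gamma vth eps : R).
Hypotheses (n_gt0 : (0 < n)%N) (hA : hurwitz Am) (ell_ge0 : 0 <= ell).
Hypotheses (gamma_gt0 : 0 < gamma) (vth_gt0 : 0 < vth) (eps_gt0 : 0 < eps).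
Hypotheses (matching : Am = Ap + b *m ths^T) (ths_le : enorm ths <= vth).
Hypotheses (sP : P^T = P) (pP : posdef P).
Hypothesis lyapP : (Am - ell%:M)^T *m P + P *m (Am - ell%:M) = - 1%:M.

Let Abar := Am - ell%:M.
Let f := @proj_bound R n vth eps.
Let thmax := vth + eps.
Let tthmax := 2 * vth + eps.
Let G : 'M[R]_n := gamma%:M.
Let alpha := (stability_margin Am + 2 * ell) / transient_gain Am ^+ 2.

Let thmax_ge0 : 0 <= thmax. Proof. by rewrite addr_ge0 ?ltW. Qed.

Lemma transient_gain_gt0 : 0 < transient_gain Am.
Proof.
rewrite /transient_gain exprn_gt0 // ltr_pwDl // divr_ge0 //.
  by rewrite mulr_ge0 // opnorm_ge0.
by rewrite ltW // stability_margin_gt0.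
Qed.

Lemma decay_numerator_gt0 : 0 < stability_margin Am + 2 * ell.
Proof. by rewrite ltr_pwDl ?mulr_ge0 // stability_margin_gt0. Qed.

Lemma decay_rate_gt0 : 0 < alpha.
Proof.
by rewrite divr_gt0 ?decay_numerator_gt0 // exprn_gt0 // transient_gain_gt0.
Qed.

Lemma adaptation_input (x e : 'cV[R]_n) :
  - (x *m e^T *m P *m b) = - dotp e (P *m b) *: x.
Proof.
rewrite -!mulmxA [e^T *m _]mx11_scalar mul_mx_scalar scaleNr.
by rewrite /dotp.
Qed.

Lemma lyap_scalar (e tth : 'cV[R]_n) :
  lyap P G e tth = dotp e (P *m e) + gamma^-1 * dotp tth tth.
Proof. by rewrite /lyap /G invmx_scalar mul_scalar_mx dotpZr. Qed.

Lemma error_solves T x xm th : closed_loop Ap Am P G b r ell f T x xm th ->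
  solves T (fun t => x t - xm t)
    (fun t => Abar *m (x t - xm t) + dotp (th t - ths) (x t) *: b).
Proof.
move=> [xS xmS _]; have := solvesB _ _ _ _ _ xS xmS.
congr (solves _ _ _); apply/funext => t.
rewrite /Abar dotpBl.
(* The matching condition trades [Ap] for [Am]; the rank-one remainder turns [th] into the parameter
   error. *)
have -> : Ap *m x t = Am *m x t - dotp ths (x t) *: b.
  rewrite matching mulmxDl -mulmxA [ths^T *m _]mx11_scalar mul_mx_scalar.
  by rewrite addrK.
rewrite mulmxBl mulmxBr mul_scalar_mx !scalerDl scaleNr.
apply/matrixP => i j; rewrite !mxE; ring.
Qed.

Section Trajectory.
Variables (T : \bar R) (x xm th : R -> 'cV[R]_n).
Hypothesis sol : closed_loop Ap Am P G b r ell f T x xm th.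
Let e t := x t - xm t.
Let tth t := th t - ths.
Let V t := lyap P G (e t) (tth t).
(** The formal derivatives of [e], [th] and [V] along the trajectory; the lemmas below show that
    they are true derivatives. *)
Let e' t := Abar *m e t + dotp (tth t) (x t) *: b.
Let th' t := Defs.proj G (th t) (- (x t *m (e t)^T *m P *m b)) f.
Let V' t := 2 * dotp (P *m e t) (e' t) + 2 * gamma^-1 * dotp (tth t) (th' t).

(** The right-hand sides of [e] and [th] involve [x], [e] and [th] but not [r], so they are
    continuous and [solves_extension] applies, although [x] alone need not be differentiable. *)
Lemma trajectory_C1 t1 : 0 < t1 -> times T t1 ->
  exists et tht : R -> 'cV[R]_n,
  [/\ forall t, t \in `[0, t1] -> et t = e t,
      forall t, t \in `[0, t1] -> tht t = th t,
      forall t, t \in `[0, t1] -> forall i,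
        is_derive t (1 : R) (fun s => et s i 0) (e' t i 0) &
      forall t, t \in `[0, t1] -> forall i,
        is_derive t (1 : R) (fun s => tht s i 0) (th' t i 0)].
Proof.
move=> t10 Tt1; have [xS xmS thS] := sol; have eS := error_solves _ _ _ _ sol.
pose W t := within `[0, t1]%classic (nbhs (t : R)).
have FW t : Filter (W t) by exact: within_filter.
have cvgS z F t : solves T z F -> `[0, t1]%classic t ->
    forall i, (fun s => z s i 0) @ W t --> z t i 0.
  move=> zS tI i.
  have /subspace_continuousP := solves_continuous _ _ _ _ (ltW t10) Tt1 zS i.
  by apply.
have cc t (c : R) : (fun _ : R => c) @ W t --> c by exact: cvg_cst.
have e'C i : {within `[0, t1], continuous (fun t => e' t i 0)}.
  apply/subspace_continuousP => t tI; rewrite -/(W t).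
  have E s : e' s i 0 = (Abar *m e s) i 0 + (dotp (th s) (x s) - dotp ths (x s)) * b i 0.
    by rewrite /e' /tth dotpBl !mxE.
  rewrite (_ : (fun s => e' s i 0) = fun s => (Abar *m e s) i 0 +
    (dotp (th s) (x s) - dotp ths (x s)) * b i 0); last by apply/funext.
  apply: (@cvgD _ _ _ (W t)).
    by apply: (@cvg_mulmx _ _ _ (W t) _ Abar e (e t)) => j; exact: cvgS eS tI j.
  apply: (@cvgM _ _ (W t)); last exact: cc.
  apply: (@cvgB _ _ _ (W t)).
    by apply: (@cvg_dotp _ _ _ (W t) _ th x) => j; [exact: cvgS thS tI j | exact: cvgS xS tI j].
  by apply: (@cvg_dotp _ _ _ (W t) _ (fun _ => ths) x) => j; [exact: cc | exact: cvgS xS tI j].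
have th'C i : {within `[0, t1], continuous (fun t => th' t i 0)}.
  apply/subspace_continuousP => t tI; rewrite -/(W t).
  apply: (@cvg_proj _ _ _ _ _ vth_gt0 eps_gt0 gamma_gt0 _ (W t) _ th
    (fun s => - (x s *m (e s)^T *m P *m b))) => j; first exact: cvgS thS tI j.
  rewrite (_ : (fun s => _) = fun s => - dotp (e s) (P *m b) * x s j 0); last first.
    by apply/funext => s; rewrite adaptation_input mxE.
  rewrite adaptation_input mxE.
  apply: (@cvgM _ _ (W t)); last exact: cvgS xS tI j.
  apply: (@cvgN _ _ _ (W t)).
  by apply: (@cvg_dotp _ _ _ (W t) _ e (fun _ => P *m b)) => l; [exact: cvgS eS tI l | exact: cc].
have [et [etE etD]] := solves_extension _ _ _ _ t10 Tt1 eS e'C.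
have [tht [thtE thtD]] := solves_extension _ _ _ _ t10 Tt1 thS th'C.
by exists et, tht.
Qed.

(** [barrier] for the squared norm of [th], fed by [proj_inward]. *)
Lemma theta_bounded t1 : 0 < t1 -> times T t1 -> enorm (th 0) <= thmax ->
  forall t, t \in `[0, t1] -> enorm (th t) <= thmax.
Proof.
move=> t10 Tt1 th0 t tI; have [et [tht [_ thtE _ thtD]]] := trajectory_C1 t1 t10 Tt1.
have I0 : 0 \in `[0, t1] by rewrite in_itv /= lexx ltW.
rewrite enorm_le // -(thtE t tI).
apply: (@barrier _ (fun s => dotp (tht s) (tht s))
  (fun s => dotp (th' s) (tht s) + dotp (tht s) (th' s)) t1) => //.
- by move=> s sI; apply: is_derive_dotp; exact: thtD.
- move=> s sI; rewrite (thtE s sI) => hs; rewrite (dotpC (th' s)).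
  have := @proj_inward _ n _ _ _ vth_gt0 eps_gt0 gamma_gt0 (th s)
    (- (x s *m (e s)^T *m P *m b)) hs.
  by rewrite -/f -/G -/(th' s); lra.
- by rewrite (thtE 0 I0) -enorm_le.
Qed.

Lemma parameter_error_le (v : 'cV[R]_n) : enorm v <= thmax ->
  enorm (v - ths) <= tthmax.
Proof.
move=> hv; apply: le_trans (ler_enormD _ _) _; rewrite enormN.
by move: hv ths_le; rewrite /thmax /tthmax; lra.
Qed.

(** After [V' <= - |e|^2], [lyapunov_upper] gives [alpha <e, P e> <= |e|^2], and the parameter part
    of [alpha V] is absorbed by the constant because [|tth| <= tthmax]. *)
Lemma lyap_derivative_le t : enorm (th t) <= thmax ->
  V' t <= - alpha * V t + alpha / gamma * tthmax ^+ 2.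
Proof.
move=> th_le.
have tt : dotp (tth t) (tth t) <= tthmax ^+ 2.
  rewrite -enorm_le; last by rewrite addr_ge0 ?mulr_ge0 ?ltW.
  exact: parameter_error_le.
have V'le : V' t <= - dotp (e t) (e t).
  have := @proj_convex _ n _ _ _ vth_gt0 eps_gt0 gamma_gt0 ths (th t)
    (- (x t *m (e t)^T *m P *m b)) ths_le.
  rewrite -/f -/G -/(th' t) -/(tth t) adaptation_input dotpZr => hp.
  (* The cross term in [<P e, b> <tth, x>] is cancelled by the bound [hp] on the adaptation term. *)
  rewrite /V' /e' dotpDr dotpZr mulrDr (lyapunov_dotp _ _ _ sP lyapP).
  have Pb : dotp (P *m e t) b = dotp (e t) (P *m b) by rewrite [RHS]dotp_mulmx sP.
  rewrite Pb; move: hp; rewrite -(ler_pM2l (_ : 0 < 2 * gamma^-1)); last first.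
    by rewrite mulr_gt0 ?invr_gt0.
  have -> : 2 * gamma^-1 * (gamma * (- dotp (e t) (P *m b) * dotp (tth t) (x t))) =
    - (2 * (dotp (tth t) (x t) * dotp (e t) (P *m b))).
    by field; rewrite gt_eqF.
  lra.
apply: le_trans V'le _.
have sg0 := decay_numerator_gt0; have m1 := transient_gain_gt0.
have m0 : 0 < transient_gain Am ^+ 2 by rewrite exprn_gt0.
have a0 := decay_rate_gt0.
have h1 : alpha * dotp (e t) (P *m e t) <= dotp (e t) (e t).
  have := lyapunov_upper n_gt0 _ _ _ hA ell_ge0 sP pP lyapP (e t).
  rewrite -(ler_pM2l a0) => /le_trans; apply; rewrite /alpha.
  by rewrite le_eqVlt; apply/orP; left; apply/eqP; field; rewrite !gt_eqF.
have h2 : alpha / gamma * dotp (tth t) (tth t) <= alpha / gamma * tthmax ^+ 2.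
  by rewrite ler_pM2l // divr_gt0.
have := lyap_scalar (e t) (tth t); rewrite -/(V t) => ->; lra.
Qed.

Lemma lyap_extension t1 : 0 < t1 -> times T t1 ->
  exists Vt : R -> R, (forall t, t \in `[0, t1] -> Vt t = V t) /\
    (forall t, t \in `[0, t1] -> is_derive t (1 : R) Vt (V' t)).
Proof.
move=> t10 Tt1; have [et [tht [etE thtE etD thtD]]] := trajectory_C1 t1 t10 Tt1.
exists (fun s => dotp (et s) (P *m et s) +
  gamma^-1 * dotp (tht s - ths) (tht s - ths)); split=> t tI.
  by rewrite (etE t tI) (thtE t tI) /V lyap_scalar.
have d1 : is_derive t (1 : R) (fun s => dotp (et s) (P *m et s))
    (dotp (e' t) (P *m et t) + dotp (et t) (P *m e' t)).
  by apply: is_derive_dotp; [exact: etD | apply: is_derive_mulmx; exact: etD].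
have d2 i : is_derive t (1 : R) (fun s => (tht s - ths) i 0) (th' t i 0).
  rewrite (_ : (fun s => _) = (fun s => tht s i 0) - cst (ths i 0)).
    by rewrite -[th' t i 0]subr0; apply: is_deriveB; exact: thtD.
  by apply/funext => s; rewrite !mxE.
have d3 : is_derive t (1 : R) (fun s => dotp (tht s - ths) (tht s - ths))
    (dotp (th' t) (tht t - ths) + dotp (tht t - ths) (th' t)).
  by apply: is_derive_dotp; exact: d2.
have -> : V' t = (dotp (e' t) (P *m et t) + dotp (et t) (P *m e' t)) +
    gamma^-1 *: (dotp (th' t) (tht t - ths) + dotp (tht t - ths) (th' t)).
  rewrite /V' (etE t tI) (thtE t tI) (dotp_mulmx P (e t)) sP -/(tth t).
  by rewrite (dotpC (e' t)) (dotpC (th' t)) /GRing.scale /=; ring.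
by apply: is_deriveD; apply: is_deriveZ.
Qed.

(** As [T] is excluded, each time lies strictly below the end of a segment on which the extensions
    exist. *)
Lemma times_above t : times T t -> exists t1, [/\ 0 < t1, t < t1 & times T t1].
Proof.
move=> [t0]; case: T => [c| |] //; rewrite ?lte_fin => tc.
  exists ((t + c) / 2); split; [lra|lra|split; [lra|rewrite lte_fin; lra]].
by exists (t + 1); split; [lra|lra|split; [lra|rewrite ltry]].
Qed.

Lemma lyap_has_derivative t : times T t ->
  has_derivative_within (times T) V t (V' t).
Proof.
move=> Tt; have [t1 [t10 tt1 Tt1]] := times_above t Tt.
have [Vt [VtE VtD]] := lyap_extension t1 t10 Tt1.
have [t0 _] := Tt.
apply: (@has_derivative_within_extension _ (times T) V Vt t t1) => //.
  by move=> s [].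
by apply: VtD; rewrite in_itv /= t0 ltW.
Qed.

(** Subtracting the equilibrium level [tthmax ^+ 2 / gamma] makes the differential inequality
    homogeneous. *)
Lemma lyap_decay t : times T t -> enorm (th 0) <= thmax ->
  V t - tthmax ^+ 2 / gamma <=
  (V 0 - tthmax ^+ 2 / gamma) * expR (- alpha * t).
Proof.
move=> Tt th0; have [t1 [t10 tt1 Tt1]] := times_above t Tt.
have [Vt [VtE VtD]] := lyap_extension t1 t10 Tt1; have [t0 _] := Tt.
have tI : t \in `[0, t1] by rewrite in_itv /= t0 ltW.
have I0 : 0 \in `[0, t1] by rewrite in_itv /= lexx ltW.
rewrite -(VtE t tI) -(VtE 0 I0).
apply: (@exp_decay _ (fun s => Vt s - tthmax ^+ 2 / gamma) V' t1) => //.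
  move=> s sI; rewrite -[V' s]subr0.
  by apply: (@is_deriveB _ _ _ Vt (cst _)); exact: VtD.
move=> s sI; rewrite (VtE s sI).
have := lyap_derivative_le s (theta_bounded t1 t10 Tt1 th0 s sI).
by rewrite mulrBr mulrA; lra.
Qed.

End Trajectory.
End ClosedLoop.

(** * Distance to the limit set *)

Section Distance.
Context {R : realType} {n : nat}.
Implicit Types (z w : 'cV[R]_n * 'cV[R]_n).

Lemma dist_to_le (E : set ('cV[R]_n * 'cV[R]_n)) z w : E w ->
  dist_to E z <= Num.sqrt (enorm (z.1 - w.1) ^+ 2 + enorm (z.2 - w.2) ^+ 2).
Proof.
move=> Ew; apply: ge_inf; last by exists w.
by exists 0 => _ [u _ <-]; exact: sqrtr_ge0.
Qed.

(** The first component is shrunk radially onto the sphere of radius [rho], at distance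
    [|z.1| - rho <= (|z.1|^2 - rho^2) / rho]. A bound linear in [d] keeps the full decay rate, which
    a square root would halve. *)
Lemma dist_to_cylinder_le z (rho d c : R) : 0 < rho -> 0 <= d ->
  enorm z.2 <= c -> enorm z.1 ^+ 2 <= rho ^+ 2 + d ->
  dist_to [set w : 'cV[R]_n * 'cV[R]_n | enorm w.1 ^+ 2 <= rho ^+ 2 /\ enorm w.2 <= c] z
    <= d / rho.
Proof.
move=> rho0 d0 z2 z1.
have [zr|rz] := leP (enorm z.1) rho.
  apply: (@le_trans _ _ 0); last by rewrite divr_ge0 // ltW.
  apply: le_trans (dist_to_le _ _ z _) _.
    by split=> //; rewrite ler_pXn2r ?nnegrE ?enorm_ge0 // ltW.
  by rewrite !subrr !enorm0 expr0n addr0 sqrtr0.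
have zp : 0 < enorm z.1 by exact: lt_trans rz.
have zn : enorm z.1 != 0 by rewrite gt_eqF.
pose k := rho / enorm z.1.
have kp : 0 <= k by rewrite divr_ge0 ?ltW.
have k1 : 0 <= 1 - k by rewrite subr_ge0 ler_pdivrMr // mul1r ltW.
apply: le_trans (dist_to_le _ _ (k *: z.1, z.2) _) _ => /=.
  by split=> //; rewrite enormZ ger0_norm // /k divfK.
rewrite subrr enorm0 expr0n addr0 sqrtr_sqr ger0_norm ?enorm_ge0 //.
have -> : z.1 - k *: z.1 = (1 - k) *: z.1 by rewrite scalerBl scale1r.
rewrite enormZ ger0_norm // mulrBl mul1r /k divfK // ler_pdivlMr //.
apply: (@le_trans _ _ (enorm z.1 ^+ 2 - rho ^+ 2)); last lra.
rewrite subr_sqr ler_wpM2l ?subr_ge0 ?ltW //; lra.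
Qed.

End Distance.

(** The rate is uniform in the initial data, and [M] and [C] depend on [e0] and [th0] but not on the
    solution or its interval [[0, T)], so the bounds are uniform in time. *)
Theorem theorem6 (R : realType) (n : nat) (n_gt0 : (0 < n)%N)
  (Ap Am P : 'M[R]_n) (b ths : 'cV[R]_n) (r : R -> R)
  (ell gamma thsmax eps : R)
  (Am_hurwitz : hurwitz Am)
  (r_bounded : exists K : R, forall t, 0 <= t -> `|r t| <= K)
  (ell_ge0 : 0 <= ell) (gamma_gt0 : 0 < gamma)
  (thsmax_gt0 : 0 < thsmax) (eps_gt0 : 0 < eps)
  (matching : Am = Ap + b *m ths^T)
  (ths_bound : enorm ths <= thsmax)
  (P_sym : P^T = P) (P_posdef : posdef P)
  (P_lyapunov : let Abar := Am - ell%:M in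
     Abar^T *m P + P *m Abar = - 1%:M) :
  let G : 'M[R]_n := gamma%:M in
  let f := proj_bound thsmax eps in
  let thmax := thsmax + eps in
  let tthmax := 2 * thsmax + eps in
  let sigma := stability_margin Am in
  let s := sym_margin Am in
  let m := transient_gain Am in
  let alpha1 := (sigma + 2 * ell) / m ^+ 2 in
  let alpha2 := (sigma + 2 * ell) / (m ^+ 2 * gamma) * tthmax ^+ 2 in
  let beta1 := 2 * (s + ell) / gamma in
  let E : set ('cV[R]_n * 'cV[R]_n) :=
    [set z | enorm z.1 ^+ 2 <= beta1 * tthmax ^+ 2 /\ enorm z.2 <= tthmax] in
  exists2 lambda : R, 0 < lambda &
  forall e0 th0 : 'cV[R]_n, enorm th0 <= thmax ->
  exists M C : R,
  forall (T : \bar R) (x xm th : R -> 'cV[R]_n),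
    (0 < T)%E ->
    closed_loop Ap Am P G b r ell f T x xm th ->
    x 0 - xm 0 = e0 -> th 0 = th0 ->
    let e t := x t - xm t in
    let tth t := th t - ths in
    let V t := lyap P G (e t) (tth t) in
    forall t, times T t ->
    [/\ enorm (e t) <= M,
        enorm (th t) <= M,
        exists2 dV, has_derivative_within (times T) V t dV &
                    dV <= - alpha1 * V t + alpha2 &
        dist_to E (e t, tth t) <= C * expR (- lambda * t)].
Proof.
rewrite /= in P_lyapunov.
move=> G f thmax tthmax sigma s m alpha1 alpha2 beta1 E.
have alpha1_gt0 : 0 < alpha1 by apply: decay_rate_gt0.
have sl0 : 0 < s + ell by apply: (sym_margin_shift_gt0 n_gt0 _ P).
have tthmax0 : 0 < tthmax by rewrite addr_gt0 ?mulr_gt0.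
have beta10 : 0 < beta1 by rewrite divr_gt0 ?mulr_gt0.
have alpha2E : alpha2 = alpha1 / gamma * tthmax ^+ 2.
  by rewrite /alpha2 /alpha1 invfM !mulrA.
(* The level [alpha2 / alpha1] towards which [V] decays; [rho] is the radius of the limit ball for
   [e]. *)
pose c := tthmax ^+ 2 / gamma.
pose rho := Num.sqrt beta1 * tthmax.
have rho0 : 0 < rho by rewrite mulr_gt0 // sqrtr_gt0.
have rho2 : rho ^+ 2 = beta1 * tthmax ^+ 2 by rewrite exprMn sqr_sqrtr // ltW.
have rhoc : rho ^+ 2 = 2 * (s + ell) * c by rewrite rho2 /beta1 /c; ring.
have EE : E = [set z : 'cV[R]_n * 'cV[R]_n |
    enorm z.1 ^+ 2 <= rho ^+ 2 /\ enorm z.2 <= tthmax] by rewrite rho2.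
exists alpha1 => // e0 th0 th0_le.
(* The positive part covers initial data already below the level [c]. *)
pose W0 := Num.max (lyap P G e0 (th0 - ths) - c) 0.
have W00 : 0 <= W0 by rewrite le_max lexx orbT.
pose d := 2 * (s + ell) * W0.
have d0 : 0 <= d by rewrite mulr_ge0 // mulr_ge0 // ltW.
exists (thmax + Num.sqrt (rho ^+ 2 + d)), (d / rho).
move=> T x xm th T0 sol e0E th0E e tth V t Tt; have [t0 _] := Tt.
have thm0 : enorm (th 0) <= thmax by rewrite th0E.
have thm0' : 0 <= thmax by rewrite addr_ge0 ?ltW.
have [t1 [t10 tt1 Tt1]] := times_above T t Tt.
have th_le : enorm (th t) <= thmax.
  apply: (theta_bounded Ap Am P b ths r ell gamma thsmax eps _ _ _ _ T x xm th _ t1) => //.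
  by rewrite in_itv /= t0 ltW.
have Vdecay : V t - c <= W0 * expR (- alpha1 * t).
  apply: (@le_trans _ _ ((V 0 - c) * expR (- alpha1 * t))).
    by apply: (lyap_decay Ap Am P b ths r ell gamma thsmax eps _ _ _ _ _ _ _ _ _ _ _ T x xm th).
  by rewrite ler_pM2r ?expR_gt0 // /W0 -e0E -th0E le_max lexx.
(* [<e, P e> <= V] and [lyapunov_lower] turn the decay of [V - c] into that of the excess over
   [rho ^+ 2]. *)
have e_le : enorm (e t) ^+ 2 <= rho ^+ 2 + d * expR (- alpha1 * t).
  rewrite sqr_enorm rhoc.
  apply: le_trans (lyapunov_lower n_gt0 _ _ _ P_sym P_posdef P_lyapunov (e t)) _.
  rewrite /d -!mulrA -!mulrDr ler_pM2l // ler_pM2l //.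
  have : dotp (e t) (P *m e t) <= V t.
    rewrite /V lyap_scalar lerDl mulr_ge0 ?dotp_ge0 // invr_ge0 ltW //.
  lra.
have ex1 : expR (- alpha1 * t) <= 1.
  by rewrite -expR0 ler_expR mulNr oppr_le0 mulr_ge0 // ltW.
split.
- rewrite -[leLHS]add0r lerD // -[enorm (e t)]ger0_norm ?enorm_ge0 // -sqrtr_sqr.
  apply: ler_wsqrtr; apply: le_trans e_le _; rewrite lerD2l.
  by rewrite ler_piMr.
- by apply: le_trans th_le _; rewrite lerDl sqrtr_ge0.
- eexists.
    by apply: (lyap_has_derivative Ap Am P b ths r ell gamma thsmax eps _ _ _ _ _ T x xm th).
  rewrite alpha2E.
  by apply: (lyap_derivative_le Am P b ths ell gamma thsmax eps).
rewrite EE mulrAC; apply: dist_to_cylinder_le => //=.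
- by rewrite mulr_ge0 // ltW // expR_gt0.
- exact: parameter_error_le.
Qed.
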